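(* Assume that $d_*\ge0$ and that $f_j>0$ for all $j\ge0$. Then: (1) if $\underline\sigma_{\underline j}=\infty$, or if [$\Phi_{\underline j}(0)=1$ and $\varphi_{0,j}(0)=1$ for all $j\ge\underline j$], then $\mathbb P(\Theta=\emptyset)=1$; (2) if $\mathbb P(\Theta=\emptyset)=1$, then $\overline\sigma_{\underline j}=\infty$, or [$\Phi_{\underline j}(0)=1$ and $\varphi_{0,j}(0)=1$ for all $j\ge\underline j$].
   Context: Tree. $\mathbb N=\{1,2,\ldots\}$; $\mathcal U$ is the set of finite words over $\mathbb N$, including the empty word $\varnothing$; $\langle u\rangle$ is the length (generation) of $u$; for $u\ne\varnothing$, $\pi(u)$ is $u$ with its last letter removed. Fix integers $m_j\ge 2$ ($j\ge 0$). For $j\ge 0$, $\mathcal U_j=\{u\in\mathcal U:\ u_i\le m_{j+i-1}\text{ for }1\le i\le\langle u\rangle\}$ and $\mathcal U_j^*=\mathcal U_j\setminus\{\varnothing\}$. For $u\in\mathcal U_0$, $u\,\mathcal U_{\langle u\rangle}$ (resp. $u\,\mathcal U_{\langle u\rangle}^*$) is the set of concatenations of $u$ with words of $\mathcal U_{\langle u\rangle}$ (resp. $\mathcal U_{\langle u\rangle}^*$). Compacts. Fix $d\ge 1$, reals $0<\underline\beta\le\overline\beta<1$, and for each $j\ge0$ a probability measure $\mu_j$ on $[\underline\beta,\overline\beta]^{m_j}$. $(J_u)_{u\in\mathcal U_0}$ is a random family of compact subsets of $\mathbb R^d$ with positive diameters $|J_u|$, such that: (A) for each $u\in\mathcal U_0$,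 the sets $J_{uk}$, $1\le k\le m_{\langle u\rangle}$, are subsets of $J_u$ with disjoint interiors; (B) there is a real $\kappa>0$ such that for each $u\in\mathcal U_0$ the Lebesgue measure of the interior of $J_u$ is at least $\kappa|J_u|^d$; (C) the ratios $L_u=|J_u|/|J_{\pi(u)}|$, $u\in\mathcal U_0^*$, are random variables and the vectors $(L_{uk})_{1\le k\le m_{\langle u\rangle}}$, $u\in\mathcal U_0$, are independent with respective distributions $\mu_{\langle u\rangle}$. Markov chain. For $j\ge0$ and $t\in\{0,1\}$ let $\nu_{t,j}$ be a probability measure on $\{0,1\}^{m_j}$. $(X_u)_{u\in\mathcal U_0}$ is a family of $\{0,1\}$-valued random variables, independent of $(L_u)_{u\in\mathcal U_0^*}$, such that for every $u\in\mathcal U_0$ and $A\subseteq\{0,1\}^{m_{\langle u\rangle}}$, $\mathbb P\big((X_{uk})_{1\le k\le m_{\langle u\rangle}}\in A\mid \mathcal G_u\big)=\nu_{X_u,\langle u\rangle}(A)$, where $\mathcal G_u=\sigma(X_v,\ v\in\mathcal U_0\setminus(u\,\mathcal U^*_{\langle u\rangle}))$. The set $\Theta$. Almost surely, for every sequence $\zeta=(\zeta_j)_{j\ge1}$ in $\mathbb N$ with $\zeta_1\ldots\zeta_j\in\mathcal U_0$ for all $j\ge 1$, the set $\bigcap_{j\ge1}J_{\zeta_1\ldots\zeta_j}$ is a single point, denoted $x_\zeta$. For $u\in\mathcal U_0$ let $\tau_u=\{v\in u\,\mathcal U_{\langle u\rangle}:\ X_{v_1\ldots v_j}=1\text{ for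 all }\langle u\rangle\le j\le\langle v\rangle\}$, $\partial\tau_u=\{\zeta\in\mathbb N^{\mathbb N}:\ \zeta_1\ldots\zeta_j\in\tau_u\text{ for all }j\ge\langle u\rangle\}$, $K_u=\{x_\zeta:\zeta\in\partial\tau_u\}$, and $\Theta=\bigcup_{u\in\mathcal U_0}K_u$. The number $d_*$. For $s\in\mathbb R$ and $j\ge0$, $\alpha_{s,j}=\int_{\{0,1\}^{m_j}}\int_{[\underline\beta,\overline\beta]^{m_j}}\sum_{k=1}^{m_j}\ell_k^s x_k\,\mu_j(d\ell)\,\nu_{1,j}(dx)$. Let $\underline j=\inf\{j_0\ge0:\ \alpha_{0,j}>0\ \text{for all } j\ge j_0\}$ (with $\inf\emptyset=\infty$). If $\underline j=\infty$, $d_*=-\infty$ (so $d_*\ge 0$ forces $\underline j<\infty$). Otherwise let $\rho(s)=\liminf_{j\to\infty}\frac1j\sum_{n=\underline j}^{j-1}\log\alpha_{s,n}$ for $s\in\mathbb R$ ($\rho$ is either identically $-\infty$ or a decreasing bijection of $\mathbb R$ onto $\mathbb R$) and $d_*=\sup\{s\in\mathbb R:\rho(s)>0\}=\inf\{s\in\mathbb R:\rho(s)<0\}\in[-\infty,\infty)$. Generating functions. For $j\ge0$, $S_j=\{u\in\mathcal U_0:\langle u\rangle=j,\ X_u=1\}$ and $\Phi_j(z)=\mathbb E[z^{\#S_j}]$ (with $0^0=1$). For $t\in\{0,1\}$, $\varphi_{t,j}(z)=\int_{\{0,1\}^{m_j}}z^{x_1+\cdots+x_{m_j}}\,\nu_{t,j}(dx)$;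 note $\varphi_{1,j}'(1)=\alpha_{0,j}$. For $j\ge 0$, $f_j=\lim_{n\to\infty}\varphi_{1,j}\circ\cdots\circ\varphi_{1,j+n}(0)$ (a nondecreasing limit). For $j\ge\underline j$, $$\underline\sigma_j=\max\Big(1,\ \sum_{n=j}^\infty\frac{\varphi_{1,n}'(1)+\varphi_{1,n}(0)-1}{\varphi_{1,n}'(1)\prod_{\ell=j}^n\varphi_{1,\ell}'(1)}+\limsup_{n\to\infty}\frac1{\prod_{\ell=j}^n\varphi_{1,\ell}'(1)}\Big),$$ $$\overline\sigma_j=\sum_{n=j}^\infty\frac{\varphi_{1,n}''(1)}{\varphi_{1,n}'(1)\prod_{\ell=j}^n\varphi_{1,\ell}'(1)}+\liminf_{n\to\infty}\frac1{\prod_{\ell=j}^n\varphi_{1,\ell}'(1)},$$ with values in $[1,\infty]$. *)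

(* Defs.v *)
From HB Require Import structures.
From mathcomp Require Import all_boot all_order all_algebra finmap.
From mathcomp Require Import all_classical all_reals all_analysis.
From mathcomp Require Import measurable_realfun.

Set Implicit Arguments.
Unset Strict Implicit.
Unset Printing Implicit Defensive.

Import Order.TTheory GRing.Theory Num.Theory.
Import numFieldNormedType.Exports.

Local Open Scope classical_set_scope.
Local Open Scope ring_scope.

Section euclidean_space.
Context {R : realType} {d : nat}.

Definition eucl_dist (x y : 'rV[R]_d) : R :=
  Num.sqrt (\sum_(i < d) (x ord0 i - y ord0 i) ^+ 2).

(* Only meaningful on bounded sets: [sup] is junk on unbounded ones. *)
Definition diam (A : set 'rV[R]_d) : R :=
  sup [set eucl_dist p.1 p.2 | p in A `*` A].

Definition box (p : 'rV[R]_d * 'rV[R]_d) : set 'rV[R]_d :=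
  [set x : 'rV[R]_d | forall i, p.1 ord0 i <= x ord0 i <= p.2 ord0 i].

Definition box_volume (p : 'rV[R]_d * 'rV[R]_d) : R :=
  \prod_(i < d) (p.2 ord0 i - p.1 ord0 i).

(* Lebesgue outer measure on R^d: the infimum of the total volumes of the
   countable coverings by boxes. On measurable sets (in particular on open
   sets) this is the Lebesgue measure. *)
Definition lebesgue_rV (A : set 'rV[R]_d) : \bar R :=
  ereal_inf [set (\sum_(k <oo) (box_volume (b k))%:E)%E |
    b in [set b : nat -> 'rV[R]_d * 'rV[R]_d |
      (forall k i, (b k).1 ord0 i <= (b k).2 ord0 i) /\
      A `<=` \bigcup_k box (b k)]].

End euclidean_space.

Section independence_and_conditioning.
Context {dO : measure_display} {Omega : measurableType dO} {R : realType}.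
Variable P : probability Omega R.

Definition sigma_rv (dT : measure_display) (T : measurableType dT) (I : Type)
    (D : set I) (Y : I -> Omega -> T) : set (set Omega) :=
  <<s \bigcup_(i in D) preimage_set_system setT (Y i) measurable >>.

Definition independent_sigma (F G : set (set Omega)) : Prop :=
  forall A B, F A -> G B -> P (A `&` B) = (P A * P B)%E.

Definition mutually_independent (dT : measure_display) (I : choiceType)
    (D : set I) (T : I -> measurableType dT) (Y : forall i, Omega -> T i) :
    Prop :=
  forall (s : seq I) (B : forall i, set (T i)),
    uniq s -> (forall i, i \in s -> D i) -> (forall i, measurable (B i)) ->
    P (\bigcap_(i in [set` s]) (Y i @^-1` B i)) =
    (\prod_(i <- s) P (Y i @^-1` B i))%E.

(* [Z] is a version of the conditional probability of [E] given [G]. *)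
Definition is_cond_prob (G : set (set Omega)) (E : set Omega)
    (Z : Omega -> \bar R) : Prop :=
  (forall B : set (\bar R), measurable B -> G (Z @^-1` B)) /\
  (forall A, G A -> (\int[P]_(w in A) Z w)%E = P (A `&` E)).

End independence_and_conditioning.

Section words.
Variable m : nat -> nat.

(* Letters are positive integers; the letter at position [i] (counted from 0)
   is the (i+1)-st one. *)
Definition U (j : nat) : set (seq nat) :=
  [set u | forall i, (i < size u)%N -> (1 <= nth 0 u i <= m (j + i))%N].

Definition Ustar (j : nat) : set (seq nat) := U j `\ [::].

Definition parent (u : seq nat) : seq nat := take (size u).-1 u.

(* [child u k] is the word denoted u(k+1): the index [k] starts from 0. *)
Definition child (u : seq nat) (k : nat) : seq nat := rcons u k.+1.

Definition concat_set (u : seq nat) (A : set (seq nat)) : set (seq nat) :=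
  [set u ++ v | v in A].

(* A sequence (zeta_j)_{j >= 1} is encoded as [zeta : nat -> nat] with
   zeta_j = [zeta j.-1]; the prefix zeta_1 ... zeta_j is [prefix_word zeta j]. *)
Definition prefix_word (zeta : nat -> nat) (j : nat) : seq nat :=
  mkseq zeta j.

End words.

Section compacts.
Context {dO : measure_display} {Omega : measurableType dO} {R : realType}.
Context {d : nat}.
Variables (P : probability Omega R) (m : nat -> nat) (blo bhi : R).
Variable mu : forall j, probability ((m j).-tuple R) R.
Variable J : seq nat -> Omega -> set 'rV[R]_d.

Definition cube {n : nat} : set (n.-tuple R) :=
  [set l | forall k, blo <= tnth l k <= bhi].

Definition Lratio (u : seq nat) (w : Omega) : R :=
  diam (J u w) / diam (J (parent u) w).

Definition Lvec (u : seq nat) (w : Omega) : (m (size u)).-tuple R :=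
  [tuple Lratio (child u k) w | k < m (size u)].

Record compact_family : Prop := {
  cf_compact : forall w u, U m 0 u -> compact (J u w) ;
  cf_diam_gt0 : forall w u, U m 0 u -> 0 < diam (J u w) ;
  cf_subset : forall w u, U m 0 u -> forall k : 'I_(m (size u)),
    J (child u k) w `<=` J u w ;
  cf_disjoint : forall w u, U m 0 u -> forall k l : 'I_(m (size u)), k != l ->
    (J (child u k) w)° `&` (J (child u l) w)° = set0 ;
  cf_volume : exists2 kappa : R, 0 < kappa & forall w u, U m 0 u ->
    ((kappa * diam (J u w) ^+ d)%:E <= lebesgue_rV ((J u w)°))%E ;
  cf_ratio_rv : forall u, Ustar m 0 u -> measurable_fun setT (Lratio u) ;
  cf_independent : mutually_independent P (U m 0) Lvec ;
  cf_distribution : forall u, U m 0 u ->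
    forall B : set ((m (size u)).-tuple R), measurable B ->
    P (Lvec u @^-1` B) = mu (size u) B
}.

End compacts.

Section chain.
Context {dO : measure_display} {Omega : measurableType dO} {R : realType}.
Variables (P : probability Omega R) (m : nat -> nat).
Variable nu : bool -> forall j, probability ((m j).-tuple bool) R.
(* The states 0 and 1 are [false] and [true]. *)
Variable X : seq nat -> Omega -> bool.

Definition Xvec (u : seq nat) (w : Omega) : (m (size u)).-tuple bool :=
  [tuple X (child u k) w | k < m (size u)].

Definition past (u : seq nat) : set (set Omega) :=
  sigma_rv (U m 0 `\` concat_set u (Ustar m (size u))) X.

Record branching_chain : Prop := {
  bc_rv : forall u, U m 0 u -> measurable_fun setT (X u) ;
  bc_markov : forall u, U m 0 u -> forall A : set ((m (size u)).-tuple bool),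
    is_cond_prob P (past u) (Xvec u @^-1` A)
      (fun w => nu (X u w) (size u) A)
}.

Definition Sgen (j : nat) (w : Omega) : set (seq nat) :=
  [set u | [/\ U m 0 u, size u = j & X u w]].

Definition Phi (j : nat) (z : R) : \bar R :=
  ('E_P [fun w => (z ^+ #|` fset_set (Sgen j w)|)%R])%E.

End chain.

Section limit_set.
Context {dO : measure_display} {Omega : measurableType dO} {R : realType}.
Context {d : nat}.
Variable m : nat -> nat.
Variable J : seq nat -> Omega -> set 'rV[R]_d.
Variable X : seq nat -> Omega -> bool.

(* The point of the intersection of the [J]'s along [zeta], whenever this
   intersection is a singleton (almost surely for all [zeta] in the tree
   boundary). *)
Definition xpoint (w : Omega) (zeta : nat -> nat) : 'rV[R]_d :=
  xget 0 (\bigcap_(j in [set j | (1 <= j)%N]) J (prefix_word zeta j) w).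

Definition tau (u : seq nat) (w : Omega) : set (seq nat) :=
  [set v | concat_set u (U m (size u)) v /\
    forall j, (size u <= j <= size v)%N -> X (take j v) w].

Definition boundary_tau (u : seq nat) (w : Omega) : set (nat -> nat) :=
  [set zeta | forall j, (size u <= j)%N -> tau u w (prefix_word zeta j)].

Definition K (u : seq nat) (w : Omega) : set 'rV[R]_d :=
  [set xpoint w zeta | zeta in boundary_tau u w].

Definition Theta (w : Omega) : set 'rV[R]_d :=
  \bigcup_(u in U m 0) K u w.

End limit_set.

Section numbers.
Context {R : realType}.
Variables (m : nat -> nat) (blo bhi : R).
Variable mu : forall j, probability ((m j).-tuple R) R.
Variable nu : bool -> forall j, probability ((m j).-tuple bool) R.

Definition alpha (s : R) (j : nat) : R :=
  \int[nu true j]_x \int[mu j]_(l in cube blo bhi)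
    \sum_(k < m j) tnth l k `^ s * (tnth x k)%:R.

Definition alpha_pos_from (j0 : nat) : bool :=
  `[< forall j, (j0 <= j)%N -> 0 < alpha 0 j >].

Definition junder_finite : Prop := exists j0, alpha_pos_from j0.

(* The infimum of [alpha_pos_from] when it is finite. When it is infinite the
   value 0 is junk: then [dstar] is -oo. *)
Definition junder : nat :=
  if pselect junder_finite is left h then ex_minn h else 0%N.

Definition rho (s : R) : \bar R :=
  limn_einf (fun j : nat =>
    (j%:R^-1 * \sum_(junder <= n < j) ln (alpha s n))%:E).

Definition dstar : \bar R :=
  if pselect junder_finite is left _ then
    ereal_sup [set s%:E | s in [set s : R | (0 < rho s)%E]]
  else -oo%E.

Definition phi (t : bool) (j : nat) (z : R) : R :=
  \int[nu t j]_x z ^+ (\sum_(k < m j) tnth x k)%N.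

Definition phi_comp (j n : nat) (z : R) : R :=
  foldr (phi true) z (iota j n.+1).

Definition fext (j : nat) : R := limn (fun n : nat => phi_comp j n 0).

Definition dphi (j : nat) : R := derive1 (phi true j) 1.

Definition ddphi (j : nat) : R := derive1n 2 (phi true j) 1.

Definition dphi_prod (j n : nat) : R := \prod_(j <= l < n.+1) dphi l.

Definition sigma_lower (j : nat) : \bar R :=
  maxe 1%E
    (\sum_(j <= n <oo)
       ((dphi n + phi true n 0 - 1) / (dphi n * dphi_prod j n))%:E
     + limn_esup (fun n : nat => ((dphi_prod j n)^-1)%:E))%E.

Definition sigma_upper (j : nat) : \bar R :=
  (\sum_(j <= n <oo) (ddphi n / (dphi n * dphi_prod j n))%:E
   + limn_einf (fun n : nat => ((dphi_prod j n)^-1)%:E))%E.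

End numbers.

(* Main.v *)
Require Import Defs.
From HB Require Import structures.
From mathcomp Require Import all_boot all_order all_algebra.
From mathcomp Require Import all_classical all_reals all_analysis.
From mathcomp Require Import measurable_realfun.
From mathcomp Require Import ring lra.

(** The set [Theta] is nonempty exactly when some word [u] starts an infinite
    line of descent all of whose individuals are in state 1, because a finitely
    branching tree with vertices in every generation has an infinite branch
    ([immortal_boundary]). The first individuals of an infinite line can be dropped, so
    only the words [u] of generation at least [j0] matter
    ([Theta_empty_event]); there are countably many of them, so [Theta] is
    almost surely empty if and only if each of them is almost surely not
    immortal.

    Below an individual of state 1, the individuals linked to it by ancestors of
    state 1 form a branching process in varying environment with offspring
    generating functions [phi nu true j]: by the Markov property, conditionally
    on the states of the children, the subtrees of the children die out
    independently ([extinction_prob]). Hence [u] is immortal with probability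
    P(X_u = 1) (1 - f), where f is [fext nu (size u)] ([immortal_prob]). From
    generation [junder] on the offspring means are positive, so that the values
    [fext nu j] are all equal to 1 or all different from 1 ([fext_eq1]).
    Therefore [Theta] is almost surely empty if and only if [fext nu j0 = 1] or
    all states of generation at least [j0] are almost surely 0; the latter means
    that generation [j0] is almost surely in state 0 and that individuals of
    state 0 have almost surely no child of state 1 from there on
    ([barren_fromP]).

    It remains to compare [fext nu j0 = 1] with the two series. For a generating
    function G of mean m, the quantity 1/(1 - G(s)) - 1/(m(1 - s)) lies between
    (m + G(0) - 1)/m^2 and G''(1)/m^2 ([inv_compl_pgf_ge],
    [inv_compl_pgf_le]). Iterating this affine recursion along the compositions
    that define [fext] bounds 1/(1 - fext) from below by the sum inside the maximum
    of [sigma_lower] and from above by [sigma_upper]; so [fext nu j0 = 1] follows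
    from an infinite [sigma_lower] and implies an infinite [sigma_upper]
    ([sigma_lower_pinfty], [fext_eq1_sigma_upper]). *)

Set Implicit Arguments.
Unset Strict Implicit.
Unset Printing Implicit Defensive.

Import Order.TTheory GRing.Theory Num.Theory.
Import numFieldNormedType.Exports.

Local Open Scope classical_set_scope.
Local Open Scope ring_scope.

(** * Reciprocal bounds for probability generating functions *)

Section powers.
Context {R : realFieldType} (s : R).
Hypothesis s01 : 0 <= s < 1.

Let s_ge0 : 0 <= s. Proof. by case/andP: s01. Qed.
Let s_le1 : s <= 1. Proof. by case/andP: s01 => _ /ltW. Qed.

(** From n + 1 to n + 2 the left-hand side grows by (1 - s)^2 and the right-hand
    side by (1 - s)(1 - s^(n+1)), which is at least as large. With 0^0 = 1,
    the factor n + 0^n - 1 is the positive part of n - 1. *)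
Lemma compl_exp_ge (n : nat) :
  (1 - s) ^+ 2 * (n%:R + 0 ^+ n - 1) <= n%:R * (1 - s) - (1 - s ^+ n).
Proof.
have s0 := s_ge0; have s1 := s_le1.
elim: n => [|[|n] IH]; first by rewrite expr0; lra.
  by rewrite !expr1; lra.
have h1 : s ^+ n.+1 <= s.
  by rewrite -[leRHS]expr1; apply: ler_wiXn2l.
have h2 : 0 <= (1 - s) * (s - s ^+ n.+1) by apply: mulr_ge0; lra.
move: IH; rewrite !expr0n /= -[n.+2]addn1 natrD exprD expr1 => IH.
nra.
Qed.

Lemma compl_exp_le (n : nat) :
  n.+1%:R * (1 - s) - (1 - s ^+ n.+1) <= (1 - s) * n%:R * (1 - s ^+ n.+1).
Proof.
have s0 := s_ge0; have s1 := s_le1.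
elim: n => [|n IH]; first by rewrite expr1; lra.
have h0 : 0 <= n%:R :> R by [].
have h1 : 0 <= s ^+ n.+1 by apply: exprn_ge0.
have h3 : 0 <= (1 - s) * (n%:R + 1) * (s ^+ n.+1 * (1 - s)).
  by rewrite !mulr_ge0 //; lra.
have h4 : 0 <= (1 - s) * s ^+ n.+1 * (1 - s) by rewrite !mulr_ge0 //; lra.
move: IH; rewrite (exprS _ n.+1) -[n.+2]addn1 -![n.+1%:R]natr1 natrD -natr1 => IH.
nra.
Qed.

Lemma compl_exp_ge_slope (b : nat) : b%:R * s ^+ b * (1 - s) <= 1 - s ^+ b.
Proof.
have s0 := s_ge0; have s1 := s_le1.
elim: b => [|b IH]; first by rewrite expr0; lra.
have h1 : 0 <= s ^+ b by apply: exprn_ge0.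
have h2 : 0 <= b%:R :> R by [].
have h3 : 0 <= (b%:R + 1) * s ^+ b * (1 - s) * (1 - s).
  by rewrite !mulr_ge0 //; lra.
rewrite exprS -natr1; nra.
Qed.

(** The ratio (1 - s^n)/((1 - s) n) is the average of 1, s, ..., s^(n-1), hence
    nonincreasing in n. *)
Lemma compl_exp_ratio_nincr (b a : nat) : (b <= a)%N ->
  b%:R * (1 - s ^+ a) <= a%:R * (1 - s ^+ b).
Proof.
have s0 := s_ge0; have s1 := s_le1.
move/subnKC <-; elim: (a - b)%N => [|n IH]; first by rewrite addn0.
have h1 : s ^+ (b + n) <= s ^+ b by apply: ler_wiXn2l => //; rewrite leq_addr.
have h2 := compl_exp_ge_slope b.
have h4 : 0 <= b%:R * (1 - s) * (s ^+ b - s ^+ (b + n)).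
  by rewrite !mulr_ge0 //; lra.
rewrite addnS exprS -natr1; nra.
Qed.

(** Symmetrised form of Chebyshev's sum inequality for the increasing function
    n - 1 and the decreasing function (1 - s^n)/n; the weights a b are those of
    a size-biased law. *)
Lemma compl_exp_chebyshev (a b : nat) :
  (a%:R * (1 - s) - (1 - s ^+ a)) * b%:R
    + (b%:R * (1 - s) - (1 - s ^+ b)) * a%:R <=
  (1 - s) * (a%:R * (a%:R - 1) * (1 - s ^+ b)
             + b%:R * (b%:R - 1) * (1 - s ^+ a)).
Proof.
have s0 := s_ge0; have s1 := s_le1.
case: a => [|a]; first by rewrite expr0; lra.
case: b => [|b]; first by rewrite expr0; lra.
have ha := compl_exp_le a; have hb := compl_exp_le b.
have ha' := ler_wpM2r (ler0n R b.+1) ha.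
have hb' := ler_wpM2r (ler0n R a.+1) hb.
apply: (le_trans (lerD ha' hb')).
have key : 0 <= (1 - s) * ((a.+1%:R - b.+1%:R) *
   (a.+1%:R * (1 - s ^+ b.+1) - b.+1%:R * (1 - s ^+ a.+1))).
  apply: mulr_ge0; first by lra.
  have [ab|ba] := leqP a b.
    have := @compl_exp_ratio_nincr a.+1 b.+1 ab.
    have : a.+1%:R <= b.+1%:R :> R by rewrite ler_nat.
    move=> h1 h2; nra.
  have := @compl_exp_ratio_nincr b.+1 a.+1 (ltnW ba).
  have : b.+1%:R <= a.+1%:R :> R by rewrite ler_nat ltnW.
  move=> h1 h2; nra.
rewrite -!natr1 in key *; nra.
Qed.

End powers.

Section pgf.
Context {R : realFieldType} {T : finType} (p : T -> R) (N : T -> nat).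

Definition pgf (z : R) : R := \sum_t p t * z ^+ N t.
Definition pmean : R := \sum_t p t * (N t)%:R.
(** The second factorial moment, equal to the second derivative of [pgf] at 1. *)
Definition pfact2 : R := \sum_t p t * ((N t)%:R * ((N t)%:R - 1)).

Hypothesis p_ge0 : forall t, 0 <= p t.
Hypothesis p_sum1 : \sum_t p t = 1.

Lemma pgf1 : pgf 1 = 1.
Proof. by rewrite -[RHS]p_sum1; apply: eq_bigr => t _; rewrite expr1n mulr1. Qed.

Lemma pgf_compl (z : R) : 1 - pgf z = \sum_t p t * (1 - z ^+ N t).
Proof.
by rewrite -[in LHS]p_sum1 -sumrB; apply: eq_bigr => t _; rewrite mulrBr mulr1.
Qed.

Lemma pgf_ge0 (z : R) : 0 <= z -> 0 <= pgf z.
Proof. by move=> z0; apply: sumr_ge0 => t _; rewrite mulr_ge0 ?exprn_ge0. Qed.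

Lemma ler_pgf (y z : R) : 0 <= y -> y <= z -> pgf y <= pgf z.
Proof.
move=> y0 yz; apply: ler_sum => t _; apply: ler_wpM2l => //.
by apply: lerXn2r => //; rewrite nnegrE // (le_trans y0).
Qed.

Lemma pgf_lt1 (s : R) : 0 < pmean -> 0 <= s < 1 -> pgf s < 1.
Proof.
move=> m0 /andP[s0 s1]; rewrite -subr_gt0 lt_def.
have nneg t : true -> 0 <= p t * (1 - s ^+ N t).
  by move=> _; rewrite mulr_ge0 // subr_ge0 exprn_ile1 // ltW.
rewrite pgf_compl sumr_ge0 // andbT; apply/eqP => /eqP.
rewrite psumr_eq0 // => /allP h.
suff : pmean = 0 by move=> e; rewrite e ltxx in m0.
apply: big1 => t _; have := h t (mem_index_enum _); rewrite /= mulf_eq0.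
case/orP => [/eqP ->|]; first by rewrite mul0r.
case: (N t) => [|n]; first by rewrite mulr0.
by rewrite subr_eq0 gt_eqF // exprn_ilt1.
Qed.

Lemma pmean_pgf0E :
  pmean + pgf 0 - 1 = \sum_t p t * ((N t)%:R + 0 ^+ N t - 1).
Proof.
rewrite -[in LHS]p_sum1 /pmean /pgf -big_split -sumrB /=; apply: eq_bigr => t _.
by rewrite mulrBr mulrDr mulr1.
Qed.

Lemma pmean_pgf0_ge1 : 0 <= pmean + pgf 0 - 1.
Proof.
rewrite pmean_pgf0E; apply: sumr_ge0 => t _; rewrite mulr_ge0 //.
case: (N t) => [|n]; first by rewrite expr0 add0r subrr.
by rewrite expr0n /= addr0 -natr1 addrK.
Qed.

Lemma pfact2_ge0 : 0 <= pfact2.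
Proof.
apply: sumr_ge0 => t _; rewrite mulr_ge0 //.
case: (N t) => [|n]; first by rewrite mul0r.
by rewrite -natr1 addrK mulr_ge0 // natr1.
Qed.

Section bounds.
Variable s : R.
Hypotheses (m_gt0 : 0 < pmean) (s01 : 0 <= s < 1).

Let compl_gt0 : 0 < 1 - pgf s. Proof. by rewrite subr_gt0 pgf_lt1. Qed.
Let compls_gt0 : 0 < 1 - s. Proof. by case/andP: s01; rewrite subr_gt0. Qed.

Let gapE : pmean * (1 - s) - (1 - pgf s) =
  \sum_t p t * ((N t)%:R * (1 - s) - (1 - s ^+ N t)).
Proof.
rewrite pgf_compl /pmean mulr_suml -sumrB; apply: eq_bigr => t _.
by ring.
Qed.

Let gap_ge : (1 - s) ^+ 2 * (pmean + pgf 0 - 1) <=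
  pmean * (1 - s) - (1 - pgf s).
Proof.
rewrite gapE pmean_pgf0E mulr_sumr.
apply: ler_sum => t _; have h := ler_wpM2l (p_ge0 t) (compl_exp_ge s01 (N t)).
by rewrite mulrCA.
Qed.

(** Averaging [compl_exp_ge] gives
    m(1 - s) - (1 - G(s)) >= (1 - s)^2 (m + G(0) - 1), and in particular
    1 - G(s) <= m(1 - s); the difference of the reciprocals is therefore at
    least that of the numerators over (m(1 - s))^2. *)
Lemma inv_compl_pgf_ge :
  (pmean + pgf 0 - 1) / pmean ^+ 2 + (pmean * (1 - s))^-1 <= (1 - pgf s)^-1.
Proof.
have m0 := m_gt0; have a0 := compl_gt0; have s0 := compls_gt0.
set c := pmean + pgf 0 - 1; have c0 : 0 <= c := pmean_pgf0_ge1.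
set a := 1 - pgf s in a0 *; set b := pmean * (1 - s).
have b0 : 0 < b by rewrite mulr_gt0.
have hg : (1 - s) ^+ 2 * c <= b - a := gap_ge.
have ab : a <= b by rewrite -subr_ge0 (le_trans _ hg) // mulr_ge0 // sqr_ge0.
rewrite -lerBrDr; have -> : a^-1 - b^-1 = (b - a) / (a * b).
  by field; rewrite !gt_eqF.
have -> : c / pmean ^+ 2 = ((1 - s) ^+ 2 * c) / (b * b).
  by rewrite /b; field; rewrite !gt_eqF.
apply: ler_pM => //; first by rewrite mulr_ge0 // sqr_ge0.
  by rewrite invr_ge0 mulr_ge0 // ltW.
by rewrite lef_pV2 ?posrE ?mulr_gt0 // ler_wpM2r // ltW.
Qed.

(** After clearing denominators, the claim is a double sum over two independent
    copies of the law; its symmetrisation is nonnegative term by term by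
    [compl_exp_chebyshev]. *)
Lemma inv_compl_pgf_le :
  (1 - pgf s)^-1 <= pfact2 / pmean ^+ 2 + (pmean * (1 - s))^-1.
Proof.
have m0 := m_gt0; have a0 := compl_gt0; have s0 := compls_gt0.
have key : (pmean * (1 - s) - (1 - pgf s)) * pmean <=
           pfact2 * ((1 - pgf s) * (1 - s)).
  rewrite gapE pgf_compl -subr_ge0.
  pose F t t' := p t * p t' * ((1 - s) * ((N t)%:R * ((N t)%:R - 1) * (1 - s ^+ N t'))
     - ((N t)%:R * (1 - s) - (1 - s ^+ N t)) * (N t')%:R).
  have -> : pfact2 * ((\sum_t p t * (1 - s ^+ N t)) * (1 - s)) -
      (\sum_t p t * ((N t)%:R * (1 - s) - (1 - s ^+ N t))) * pmean =
      \sum_t \sum_t' F t t'.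
    rewrite mulrA /pfact2 /pmean !big_distrlr /= mulr_suml -sumrB.
    apply: eq_bigr => t _; rewrite mulr_suml -sumrB; apply: eq_bigr => t' _.
    by rewrite /F; ring.
  have dbl : (\sum_t \sum_t' F t t') *+ 2 = \sum_t \sum_t' (F t t' + F t' t).
    rewrite mulr2n {2}exchange_big -big_split; apply: eq_bigr => t _.
    by rewrite big_split.
  rewrite -(pmulrn_lge0 _ (isT : (0 < 2)%N)) dbl.
  apply: sumr_ge0 => t _; apply: sumr_ge0 => t' _.
  have := compl_exp_chebyshev s01 (N t) (N t').
  have : 0 <= p t * p t' by rewrite mulr_ge0.
  rewrite /F; set q := p t * p t'; rewrite [p t' * p t]mulrC -/q => q0.
  rewrite -subr_ge0 => h; have := mulr_ge0 q0 h; lra.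
rewrite -lerBlDr; have -> : (1 - pgf s)^-1 - (pmean * (1 - s))^-1 =
  ((pmean * (1 - s) - (1 - pgf s)) * pmean) /
    ((1 - pgf s) * (1 - s) * pmean ^+ 2).
  by field; rewrite !gt_eqF.
rewrite ler_pdivrMr ?mulr_gt0 //.
apply: (le_trans key).
by rewrite le_eqVlt; apply/orP; left; apply/eqP; field; rewrite !gt_eqF.
Qed.

End bounds.
End pgf.

(** * Probability measures on tuples of booleans *)

(** Singletons are finite intersections of coordinate events, and every set of
    tuples is a finite union of singletons. *)
Lemma measurable_tuple_bool (n : nat) (A : set (n.-tuple bool)) : measurable A.
Proof.
have -> : A = \bigcup_(x in A) \bigcap_(k in [set: 'I_n])
    ((fun y => tnth y k) @^-1` [set tnth x k]).
  apply/seteqP; split=> [x Ax|y [x Ax xy]]; first by exists x.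
  suff <- : x = y by [].
  by apply: eq_from_tnth => k; rewrite (xy k).
apply: fin_bigcup_measurable => // x _; apply: fin_bigcap_measurable => // k _.
by rewrite -[X in measurable X]setTI; apply: measurable_tnth.
Qed.

Section finite_law.
Context {R : realType} {n : nat} (nu : probability (n.-tuple bool) R).

Definition mass (x : n.-tuple bool) : R := fine (nu [set x]).

Definition ones (x : n.-tuple bool) : nat := (\sum_(k < n) tnth x k)%N.

Lemma mass_ge0 x : 0 <= mass x.
Proof. by rewrite fine_ge0. Qed.

Lemma massE x : nu [set x] = (mass x)%:E.
Proof.
by rewrite fineK // fin_num_measure //; apply: measurable_tuple_bool.
Qed.

Lemma Rintegral_mass (f : n.-tuple bool -> R) :
  \int[nu]_x f x = \sum_x mass x * f x.
Proof.
have mb := @measurable_tuple_bool n.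
have intI t : nu.-integrable setT (fun x => (\1_[set t] x)%:E : \bar R).
  exact: integrable_indic.
rewrite /Rintegral (eq_integral (fun x =>
  (\sum_t (f t)%:E * (\1_[set t] x)%:E)%E)); last first.
  move=> x _; rewrite (bigD1 x) //= big1 ?adde0 => [|t tx].
    by rewrite indicE mem_set // mule1.
  by rewrite indicE memNset ?mule0 //= => xt; rewrite xt eqxx in tx.
rewrite integral_sum //; last by move=> t; apply: integrableZl.
rewrite (eq_bigr (fun t => (mass t * f t)%:E)) ?sumEFin // => t _.
by rewrite integralZl // integral_indic // setIT mulrC EFinM -massE.
Qed.

Lemma mass_sum1 : \sum_x mass x = 1.
Proof.
have := Rintegral_mass (fun=> 1).
have e : fine (nu setT) = 1 by rewrite probability_setT.
rewrite Rintegral_cst // mul1r => h.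
apply: etrans (etrans (esym h) e).
by apply: eq_bigr => x _; rewrite mulr1.
Qed.

End finite_law.

Section offspring.
Context {R : realType} {m : nat -> nat}.
Variable nu : bool -> forall j, probability ((m j).-tuple bool) R.

Lemma phiE t j : phi nu t j = pgf (mass (nu t j)) (@ones (m j)).
Proof. by apply/funext => z; rewrite /phi Rintegral_mass. Qed.

Lemma phi_horner t j : phi nu t j =
  horner (\sum_x (mass (nu t j) x)%:P * 'X^(ones x)).
Proof.
apply/funext => z; rewrite phiE horner_sum; apply: eq_bigr => x _.
by rewrite !hornerE.
Qed.

Lemma dphiE j : dphi nu j = pmean (mass (nu true j)) (@ones (m j)).
Proof.
rewrite /dphi phi_horner -derivE raddf_sum horner_sum; apply: eq_bigr => x _.
by rewrite /= derivM derivC mul0r add0r derivXn hornerM hornerC hornerMn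
  hornerXn expr1n.
Qed.

Lemma ddphiE j : ddphi nu j = pfact2 (mass (nu true j)) (@ones (m j)).
Proof.
rewrite /ddphi phi_horner /= /derive1n /= -!derivE !raddf_sum horner_sum.
apply: eq_bigr => x _.
rewrite /= derivM derivC mul0r add0r derivXn derivM derivC mul0r add0r derivMn.
rewrite derivXn hornerM hornerC !hornerMn hornerXn expr1n -mulrnA.
congr (_ * _); case: (ones x) => [|k]; first by rewrite muln0 mul0r.
by rewrite natrM mulrC -[k.+1%:R in RHS]natr1 addrK natr1.
Qed.

Lemma continuous_phi t j : continuous (phi nu t j).
Proof. by rewrite phi_horner; apply: continuous_horner. Qed.

End offspring.

Lemma measurable_cube (R : realType) (blo bhi : R) (n : nat) :
  measurable (cube blo bhi : set (n.-tuple R)).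
Proof.
have -> : cube blo bhi = \bigcap_(k in [set: 'I_n])
    ((fun y : n.-tuple R => tnth y k) @^-1` `[blo, bhi]%classic).
  apply/seteqP; split=> [x h k _|x h k] /=; first by rewrite in_itv /=.
  by have := h k I; rewrite /= in_itv.
apply: fin_bigcap_measurable => // k _.
by rewrite -[X in measurable X]setTI; apply: measurable_tnth.
Qed.

Lemma alpha0E (R : realType) (m : nat -> nat) (blo bhi : R)
  (mu : forall j, probability ((m j).-tuple R) R)
  (hmu : forall j, mu j (cube blo bhi) = 1%E)
  (nu : bool -> forall j, probability ((m j).-tuple bool) R) (j : nat) :
  alpha blo bhi mu nu 0 j = dphi nu j.
Proof.
rewrite /alpha Rintegral_mass dphiE; apply: eq_bigr => x _; congr (_ * _).
under eq_Rintegral => l _.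
  under eq_bigr do rewrite powRr0 mul1r.
  over.
have e : fine (mu j (cube blo bhi)) = 1 by rewrite hmu.
rewrite Rintegral_cst; last exact: measurable_cube.
by rewrite /ones natr_sum; apply: etrans (congr1 _ e) _; rewrite mulr1.
Qed.

(** * Extinction in a varying environment *)

Section ereal_limits.
Context {R : realType}.
Local Open Scope ereal_scope.

Lemma limn_esup_le_ub (u : (\bar R)^nat) (M : \bar R) :
  (forall n, u n <= M) -> limn_esup u <= M.
Proof.
move=> uM; apply: (@le_trans _ _ (ereal_sup (u @` setT))).
  by apply: ereal_inf_lbound; exists setT => //; apply: filterT.
by apply: ub_ereal_sup => _ [n _ <-].
Qed.

Lemma limn_einf_ge_lb (u : (\bar R)^nat) (M : \bar R) (k : nat) :
  (forall n, (k <= n)%N -> M <= u n) -> M <= limn_einf u.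
Proof.
move=> Mu; rewrite -[leRHS]/(limf_einf u \oo) limf_einfE.
apply: (@le_trans _ _ (ereal_inf (u @` [set n | (k <= n)%N]))).
  by apply: le_ereal_inf_tmp => _ [n /= kn <-]; apply: Mu.
apply: ereal_sup_ubound; exists [set n | (k <= n)%N] => //.
exact: nbhs_infty_ge.
Qed.

End ereal_limits.

(** Each step of the recursion divides the remainder by [a j], which produces the
    products in the denominators. The sign of [c] is free: an upper bound uses
    [c = 1], and a lower bound is the same statement for the opposite sequence
    with [c = -1]. *)
Lemma unroll_affine_recursion (R : realFieldType) (a t : nat -> R) (c : R)
    (x : nat -> nat -> R) (j0 : nat) :
  (forall j, (j0 <= j)%N -> 0 < a j) ->
  (forall j, (j0 <= j)%N -> x j 0 <= t j / a j ^+ 2 + c / a j) ->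
  (forall j n, (j0 <= j)%N -> x j n.+1 <= t j / a j ^+ 2 + x j.+1 n / a j) ->
  forall n j, (j0 <= j)%N -> x j n <=
    \sum_(j <= k < (j + n).+1) t k / (a k * \prod_(j <= l < k.+1) a l)
    + c / \prod_(j <= l < (j + n).+1) a l.
Proof.
move=> a_gt0 x0 xS; elim=> [|n IH] j j0j; have aj := a_gt0 _ j0j.
  by rewrite addn0 !big_nat1 -expr2; apply: x0.
apply: (le_trans (xS _ _ j0j)); rewrite [X in _ <= X + _]big_ltn ?ltnS ?leq_addr //.
rewrite big_nat1 -expr2 -addrA lerD2l.
have -> : \sum_(j.+1 <= k < (j + n.+1).+1)
      t k / (a k * \prod_(j <= l < k.+1) a l)
    + c / \prod_(j <= l < (j + n.+1).+1) a l =
  (\sum_(j.+1 <= k < (j.+1 + n).+1)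
      t k / (a k * \prod_(j.+1 <= l < k.+1) a l)
    + c / \prod_(j.+1 <= l < (j.+1 + n).+1) a l) / a j.
  rewrite addnS -addSn mulrDl mulr_suml; congr (_ + _); last first.
    have h : (j < (j.+1 + n).+1)%N by rewrite addSn !ltnS leqW ?leq_addr.
    by rewrite (big_ltn h) invfM mulrA mulrAC.
  apply: eq_big_nat => k /andP[jk _].
  by rewrite (big_ltn (ltnW _)) // mulrCA invfM [(a j)^-1 * _]mulrC mulrA.
by rewrite ler_wpM2r ?invr_ge0 ?(ltW aj) // IH // leqW.
Qed.

Section extinction.
Context {R : realType} {m : nat -> nat}.
Variable nu : bool -> forall j, probability ((m j).-tuple bool) R.

Lemma phi_comp0 j z : phi_comp nu j 0 z = phi nu true j z.
Proof. by []. Qed.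

Lemma phi_compS j n z :
  phi_comp nu j n.+1 z = phi nu true j (phi_comp nu j.+1 n z).
Proof. by []. Qed.

Lemma phi1 t j : phi nu t j 1 = 1.
Proof. by rewrite phiE pgf1 // mass_sum1. Qed.

Lemma phi_itv t j z : 0 <= z <= 1 -> 0 <= phi nu t j z <= 1.
Proof.
move=> /andP[z0 z1]; rewrite phiE pgf_ge0 //=; last exact: mass_ge0.
rewrite -[leRHS](phi1 t j) phiE ler_pgf //; exact: mass_ge0.
Qed.

Lemma ler_phi t j y z : 0 <= y -> y <= z -> phi nu t j y <= phi nu t j z.
Proof. by move=> y0 yz; rewrite phiE ler_pgf //; exact: mass_ge0. Qed.

Lemma phi_lt1 j z : 0 < dphi nu j -> 0 <= z < 1 -> phi nu true j z < 1.
Proof.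
rewrite dphiE phiE => mpos z01; apply: pgf_lt1 => //; first exact: mass_ge0.
exact: mass_sum1.
Qed.

Lemma phi_comp_itv j n z : 0 <= z <= 1 -> 0 <= phi_comp nu j n z <= 1.
Proof.
move=> z01; elim: n j => [|n IH] j; first exact: phi_itv.
by rewrite phi_compS; apply: phi_itv.
Qed.

Let z01 : (0 : R) <= (0 : R) <= 1. Proof. by rewrite lexx ler01. Qed.

Lemma nondecreasing_phi_comp0 j : nondecreasing_seq (fun n => phi_comp nu j n 0).
Proof.
apply/nondecreasing_seqP => n; elim: n j => [|n IH] j; rewrite phi_compS.
  by have /andP[h _] := phi_itv true j.+1 z01; rewrite phi_comp0; apply: ler_phi.
by have /andP[h _] := phi_comp_itv j.+1 n z01; apply: ler_phi.
Qed.

Lemma is_cvg_phi_comp0 j : cvgn (fun n => phi_comp nu j n 0).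
Proof.
apply: nondecreasing_is_cvgn; first exact: nondecreasing_phi_comp0.
by exists 1 => _ [n _ <-]; case/andP: (phi_comp_itv j n z01).
Qed.

Lemma phi_comp0_le_fext j n : phi_comp nu j n 0 <= fext nu j.
Proof.
by apply: nondecreasing_cvgn_le;
  [exact: nondecreasing_phi_comp0 | exact: is_cvg_phi_comp0].
Qed.

Lemma fext_itv j : 0 <= fext nu j <= 1.
Proof.
apply/andP; split.
  by apply: le_trans (phi_comp0_le_fext j 0); case/andP: (phi_itv true j z01).
apply: limr_le; first exact: is_cvg_phi_comp0.
by apply: nearW => n; case/andP: (phi_comp_itv j n z01).
Qed.

(** Passing to the limit in [phi_compS], since [phi nu true j] is a polynomial
    function. *)
Lemma fext_phi j : fext nu j = phi nu true j (fext nu j.+1).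
Proof.
have h1 : (fun n => phi_comp nu j n.+1 0) @ \oo --> fext nu j.
  by rewrite (cvg_shiftS (fun n => phi_comp nu j n 0)); exact: is_cvg_phi_comp0.
have h2 : (fun n => phi_comp nu j n.+1 0) @ \oo -->
    phi nu true j (fext nu j.+1).
  under eq_fun do rewrite phi_compS.
  apply: continuous_cvg; first exact: continuous_phi.
  exact: is_cvg_phi_comp0.
exact: (cvg_unique _ h1 h2).
Qed.

Section supercritical_tail.
Variable j0 : nat.
Hypothesis dphi_gt0 : forall j, (j0 <= j)%N -> 0 < dphi nu j.

Lemma phi_comp0_lt1 j n : (j0 <= j)%N -> phi_comp nu j n 0 < 1.
Proof.
elim: n j => [|n IH] j j0j; first by rewrite phi_comp0 phi_lt1 ?dphi_gt0 ?lexx ?ltr01.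
rewrite phi_compS phi_lt1 ?dphi_gt0 // IH ?(leqW j0j) // andbT.
by case/andP: (phi_comp_itv j.+1 n z01).
Qed.

(** A generating function of positive mean fixes 1 and maps [0, 1[ into itself,
    so by [fext_phi] consecutive values are simultaneously equal to 1. *)
Lemma fext_eq1 j : (j0 <= j)%N -> (fext nu j == 1) = (fext nu j0 == 1).
Proof.
elim: j => [|j IH]; first by rewrite leqn0 => /eqP ->.
rewrite leq_eqVlt => /orP[/eqP -> //|]; rewrite ltnS => j0j.
rewrite -IH // fext_phi [in RHS]fext_phi -fext_phi.
apply/eqP/eqP => [->|]; first exact: phi1.
apply: contra_eq => f1; rewrite lt_eqF // phi_lt1 ?dphi_gt0 //.
by case/andP: (fext_itv j.+1) => -> /=; rewrite lt_neqAle f1.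
Qed.

Let y j n := (1 - phi_comp nu j n 0)^-1.

Let y_gt0 j n : (j0 <= j)%N -> 0 < y j n.
Proof. by move=> j0j; rewrite invr_gt0 subr_gt0 phi_comp0_lt1. Qed.

Let mass_ge0' j x : 0 <= mass (nu true j) x. Proof. exact: mass_ge0. Qed.
Let mass_sum1' j : \sum_x mass (nu true j) x = 1. Proof. exact: mass_sum1. Qed.

Lemma inv_compl_phi_comp_le n j : (j0 <= j)%N ->
  (1 - phi_comp nu j n 0)^-1 <=
  \sum_(j <= k < (j + n).+1) ddphi nu k / (dphi nu k * dphi_prod nu j k)
  + (dphi_prod nu j (j + n))^-1.
Proof.
move=> j0j; rewrite -[X in _ <= _ + X]mul1r.
rewrite /dphi_prod; apply: (@unroll_affine_recursion _ (dphi nu) (ddphi nu) 1 y j0) => //.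
- move=> i j0i.
  have := @inv_compl_pgf_le _ _ _ (@ones (m i)) (@mass_ge0' i) (mass_sum1' i).
  rewrite -dphiE -ddphiE -phiE => /(_ 0); rewrite subr0 mulr1 mul1r; apply.
    exact: dphi_gt0.
  by rewrite lexx ltr01.
- move=> i k j0i.
  have := @inv_compl_pgf_le _ _ _ (@ones (m i)) (@mass_ge0' i) (mass_sum1' i).
  rewrite -dphiE -ddphiE -phiE /y phi_compS => /(_ (phi_comp nu i.+1 k 0)).
  rewrite [X in _ <= _ + X]invfM [X in _ <= _ + X]mulrC; apply; first exact: dphi_gt0.
  case/andP: (phi_comp_itv i.+1 k z01) => -> _ /=.
  by rewrite phi_comp0_lt1 // leqW.
Qed.

Lemma inv_compl_phi_comp_ge n j : (j0 <= j)%N ->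
  \sum_(j <= k < (j + n).+1)
    (dphi nu k + phi nu true k 0 - 1) / (dphi nu k * dphi_prod nu j k)
  + (dphi_prod nu j (j + n))^-1 <= (1 - phi_comp nu j n 0)^-1.
Proof.
move=> j0j; rewrite -lerN2.
have -> : - (\sum_(j <= k < (j + n).+1)
    (dphi nu k + phi nu true k 0 - 1) / (dphi nu k * dphi_prod nu j k)
  + (dphi_prod nu j (j + n))^-1) =
  \sum_(j <= k < (j + n).+1)
    (- (dphi nu k + phi nu true k 0 - 1)) / (dphi nu k * dphi_prod nu j k)
  + -1 / dphi_prod nu j (j + n).
  rewrite opprD mulN1r -sumrN; congr (_ + _).
  by apply: eq_bigr => k _; rewrite mulNr.
rewrite /dphi_prod; apply: (@unroll_affine_recursion _ (dphi nu)
  (fun k => - (dphi nu k + phi nu true k 0 - 1)) (-1)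
  (fun j n => - y j n) j0) => //.
- move=> i j0i.
  have := @inv_compl_pgf_ge _ _ _ (@ones (m i)) (@mass_ge0' i) (mass_sum1' i).
  rewrite -dphiE -phiE => /(_ 0); rewrite subr0 mulr1 => h.
  rewrite mulNr mulN1r -opprD lerN2; apply: h; first exact: dphi_gt0.
  by rewrite lexx ltr01.
- move=> i k j0i.
  have := @inv_compl_pgf_ge _ _ _ (@ones (m i)) (@mass_ge0' i) (mass_sum1' i).
  rewrite -dphiE -phiE /y phi_compS => /(_ (phi_comp nu i.+1 k 0)) h.
  rewrite !mulNr -opprD lerN2 [X in _ + X <= _]mulrC -invfM.
  apply: h; first exact: dphi_gt0.
  case/andP: (phi_comp_itv i.+1 k z01) => -> _ /=.
  by rewrite phi_comp0_lt1 // leqW.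
Qed.

Lemma dphi_prod_gt0 j n : (j0 <= j)%N -> 0 < dphi_prod nu j n.
Proof.
move=> j0j; rewrite /dphi_prod big_seq; apply: prodr_gt0 => l.
by rewrite mem_index_iota => /andP[jl _]; apply: dphi_gt0; apply: leq_trans jl.
Qed.

Let term_lo k : (j0 <= k)%N ->
  0 <= (dphi nu k + phi nu true k 0 - 1) / (dphi nu k * dphi_prod nu j0 k).
Proof.
move=> j0k; rewrite divr_ge0 //.
  by rewrite dphiE phiE pmean_pgf0_ge1.
by rewrite mulr_ge0 // ltW ?dphi_gt0 ?dphi_prod_gt0.
Qed.

Let term_hi k : (j0 <= k)%N ->
  0 <= ddphi nu k / (dphi nu k * dphi_prod nu j0 k).
Proof.
move=> j0k; rewrite divr_ge0 //.
  by rewrite ddphiE pfact2_ge0.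
by rewrite mulr_ge0 // ltW ?dphi_gt0 ?dphi_prod_gt0.
Qed.

(** If the extinction probability f were less than 1, all reciprocals
    1/(1 - phi_comp nu j0 n 0) would be at most 1/(1 - f), which would bound both
    the partial sums and the reciprocal products. *)
Lemma sigma_lower_pinfty : sigma_lower nu j0 = +oo%E -> fext nu j0 = 1.
Proof.
apply: contra_eq => f1.
have flt1 : fext nu j0 < 1 by case/andP: (fext_itv j0) => _; rewrite lt_neqAle f1.
pose C := (1 - fext nu j0)^-1.
have yC n : y j0 n <= C.
  rewrite lef_pV2 ?posrE ?subr_gt0 ?phi_comp0_lt1 //.
  by rewrite lerD2l lerN2 phi_comp0_le_fext.
have hC n := le_trans (inv_compl_phi_comp_ge n (leqnn j0)) (yC n).
have p0 n : 0 <= (dphi_prod nu j0 n)^-1 by rewrite invr_ge0 ltW ?dphi_prod_gt0.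
have s0 n : 0 <= \sum_(j0 <= k < n)
    (dphi nu k + phi nu true k 0 - 1) / (dphi nu k * dphi_prod nu j0 k).
  rewrite big_seq; apply: sumr_ge0 => k.
  by rewrite mem_index_iota => /andP[? _]; apply: term_lo.
have C0 : 0 <= C by rewrite invr_ge0 subr_ge0 ltW.
have hS : (\sum_(j0 <= k <oo)
    ((dphi nu k + phi nu true k 0 - 1) / (dphi nu k * dphi_prod nu j0 k))%:E
    <= C%:E)%E.
  apply: lime_le.
    by apply: is_cvg_nneseries => k j0k _; rewrite lee_fin term_lo.
  apply: nearW => n; rewrite sumEFin lee_fin.
  case: (leqP n j0) => [nj0|]; first by rewrite big_geq.
  case: n => // n; rewrite ltnS => /subnKC <-.
  by apply: le_trans (hC (n - j0)%N); rewrite lerDl.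
(* The empty products for n < j0 are equal to 1, hence the maximum. *)
have hP : (limn_esup (fun n : nat => ((dphi_prod nu j0 n)^-1)%:E) <= (Num.max 1 C)%:E)%E.
  apply: limn_esup_le_ub => n; rewrite lee_fin le_max; apply/orP.
  case: (leqP j0 n) => [/subnKC <-|nj0]; [right|left].
    by apply: le_trans (hC (n - j0)%N); rewrite lerDr.
  by rewrite /dphi_prod big_geq // invr1.
rewrite lt_eqF // /sigma_lower gt_max ltry /=.
by apply: le_lt_trans (leeD hS hP) _; rewrite -EFinD ltry.
Qed.

(** If the series and the limit inferior were finite, the reciprocals
    1/(1 - phi_comp nu j0 n 0) would be bounded along a subsequence, hence for
    all n by monotonicity, and the limit of [phi_comp nu j0 n 0] would be less
    than 1. *)
Lemma fext_eq1_sigma_upper : fext nu j0 = 1 -> sigma_upper nu j0 = +oo%E.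
Proof.
move=> f1; apply/eqP; rewrite -leye_eq leNgt; apply/negP.
rewrite /sigma_upper; set S := (\sum_(_ <= _ <oo) _)%E => hlt.
have S0 : (0 <= S)%E by apply: nneseries_ge0 => k j0k _; rewrite lee_fin term_hi.
have p0 n : 0 <= (dphi_prod nu j0 n)^-1.
  case: (leqP j0 n) => nj0; first by rewrite invr_ge0 ltW ?dphi_prod_gt0.
  by rewrite /dphi_prod big_geq // invr1.
have L0 : (0 <= limn_einf (fun n : nat => ((dphi_prod nu j0 n)^-1)%:E))%E.
  by apply: (@limn_einf_ge_lb _ _ _ 0%N) => n _; rewrite lee_fin.
have [s Ss] : exists s, S = s%:E.
  exists (fine S); rewrite fineK // ge0_fin_numE //.
  by apply: le_lt_trans hlt; rewrite leeDl.
set L := limn_einf _ in L0 hlt.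
have [l Ll] : exists l, L = l%:E.
  exists (fine L); rewrite fineK // ge0_fin_numE //.
  by apply: le_lt_trans hlt; rewrite leeDr.
have l0 : 0 <= l by rewrite -lee_fin -Ll.
have s0 : 0 <= s by rewrite -lee_fin -Ss.
pose C := s + (l + 1).
have C0 : 0 < C by rewrite /C; lra.
have freq k : exists2 n, (k <= n)%N & (dphi_prod nu j0 (j0 + n))^-1 < l + 1.
  apply: contrapT => /forall2NP h.
  (* If the reciprocal products stayed above l + 1, so would their limit
     inferior l. *)
  suff : ((l + 1)%:E <= l%:E)%E by rewrite lee_fin; lra.
  rewrite -Ll; apply: (@limn_einf_ge_lb _ _ _ (j0 + k)) => n kn.
  have j0n : (j0 <= n)%N by apply: leq_trans kn; rewrite leq_addr.
  case: (h (n - j0)%N) => [/negP|/negP]; first by rewrite leq_subRL // kn.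
  by rewrite subnKC // -leNgt lee_fin.
have yC k : y j0 k <= C.
  have [n kn hn] := freq k.
  apply: (@le_trans _ _ (y j0 n)).
    rewrite lef_pV2 ?posrE ?subr_gt0 ?phi_comp0_lt1 // lerD2l lerN2.
    exact: nondecreasing_phi_comp0.
  apply: (le_trans (inv_compl_phi_comp_le n (leqnn j0))).
  apply: lerD; last exact: ltW.
  rewrite -lee_fin -Ss -sumEFin; apply: nneseries_lim_ge => i j0i _.
  by rewrite lee_fin term_hi.
have : fext nu j0 <= 1 - C^-1.
  apply: limr_le; first exact: is_cvg_phi_comp0.
  apply: nearW => n; rewrite lerBrDr addrC -lerBrDr.
  by rewrite -[leRHS]invrK lef_pV2 ?posrE ?y_gt0 // yC.
have : 0 < C^-1 by rewrite invr_gt0.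
by rewrite f1; lra.
Qed.

End supercritical_tail.
End extinction.

(** * Words and sigma-algebras generated by states *)

Section tree_words.
Variable m : nat -> nat.

Lemma size_child (u : seq nat) (k : nat) : size (child u k) = (size u).+1.
Proof. by rewrite size_rcons. Qed.

Lemma U_child (u : seq nat) (k : nat) :
  U m 0 u -> (k < m (size u))%N -> U m 0 (child u k).
Proof.
move=> Uu km i; rewrite size_child ltnS nth_rcons add0n leq_eqVlt.
move=> /predU1P[->|iu]; first by rewrite ltnn eqxx.
by rewrite iu; apply: Uu.
Qed.

Lemma U_cat (u v : seq nat) : U m 0 u -> U m (size u) v -> U m 0 (u ++ v).
Proof.
move=> Uu Uv i; rewrite size_cat nth_cat.
case: (ltnP i (size u)) => [iu _|ui isz]; first exact: Uu.
have := Uv (i - size u)%N; rewrite add0n subnKC //; apply.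
by rewrite ltn_subLR.
Qed.

Lemma U_childP (u : seq nat) (n : nat) : U m 0 u -> size u = n.+1 ->
  exists v (k : 'I_(m (size v))), [/\ U m 0 v, size v = n & u = child v k].
Proof.
case/lastP: u => // v x Uu; rewrite size_rcons => -[sv].
have Uv : U m 0 v.
  move=> i iv; have := Uu i; rewrite size_rcons nth_rcons iv; apply.
  exact: leq_trans iv _.
have := Uu (size v); rewrite size_rcons nth_rcons ltnn eqxx add0n => /(_ (leqnn _)).
case: x Uu => // x _ /= xm.
by exists v, (Ordinal xm).
Qed.

Lemma descendantE (u v : seq nat) : concat_set u (Ustar m (size u)) v ->
  take (size u) v = u /\ (size u < size v)%N.
Proof.
move=> [v' [_ v'0] <-]; rewrite take_size_cat // size_cat; split=> //.
by case: v' v'0 => [[]//|x v' _] /=; rewrite addnS ltnS leq_addr.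
Qed.

Lemma descendant_parent (u v : seq nat) (k : 'I_(m (size u))) :
  concat_set (child u k) (Ustar m (size (child u k))) v ->
  concat_set u (Ustar m (size u)) v.
Proof.
move=> [v' [Uv' v'0] <-]; exists (k.+1 :: v'); last by rewrite cat_rcons.
split=> // -[_ /=|i /=]; first by rewrite addn0 ltn_ord.
by rewrite ltnS => /Uv'; rewrite size_child addSnnS.
Qed.

Lemma child_inj (u : seq nat) (k l : nat) : child u k = child u l -> k = l.
Proof. by move/rcons_inj => []. Qed.

End tree_words.

Section generated_events.
Context {dO : measure_display} {Omega : measurableType dO}.
Variable X : seq nat -> Omega -> bool.

Lemma sigma_rvS (D E : set (seq nat)) :
  D `<=` E -> sigma_rv D X `<=` sigma_rv E X.
Proof. by move=> DE; apply: sub_sigma_algebra2; apply: bigcup_subset. Qed.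

Variable D : set (seq nat).

Lemma sigma_rvC (A : set Omega) : sigma_rv D X A -> sigma_rv D X (~` A).
Proof. by rewrite -setTD; apply: sigma_algebraCD. Qed.

Lemma sigma_rvU (A B : set Omega) :
  sigma_rv D X A -> sigma_rv D X B -> sigma_rv D X (A `|` B).
Proof.
move=> DA DB; rewrite -bigcup2E; apply: sigma_algebra_bigcup => -[|[|i]] //=.
exact: sigma_algebra0.
Qed.

Lemma sigma_rvI (A B : set Omega) :
  sigma_rv D X A -> sigma_rv D X B -> sigma_rv D X (A `&` B).
Proof.
move=> DA DB; rewrite -(setCK (A `&` B)) setCI.
by apply: sigma_rvC; apply: sigma_rvU; apply: sigma_rvC.
Qed.

Lemma sigma_rvT : sigma_rv D X setT.
Proof. by rewrite -setC0; apply: sigma_rvC; apply: sigma_algebra0. Qed.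

Lemma sigma_rv_state (u : seq nat) (B : set bool) :
  D u -> sigma_rv D X (X u @^-1` B).
Proof.
by move=> Du; apply: sub_sigma_algebra; exists u => //; exists B => //; rewrite setTI.
Qed.

Lemma sigma_rv_all (I : eqType) (s : seq I) (F : I -> pred Omega) :
  (forall i, i \in s -> sigma_rv D X [set w | F i w]) ->
  sigma_rv D X [set w | all (F^~ w) s].
Proof.
elim: s => [|i s IH] DF.
  rewrite [X in sigma_rv _ _ X](_ : _ = setT); first exact: sigma_rvT.
  by apply/seteqP; split.
rewrite [X in sigma_rv _ _ X](_ : _ = [set w | F i w] `&` [set w | all (F^~ w) s]).
  apply: sigma_rvI; first by apply: DF; rewrite mem_head.
  by apply: IH => k ks; apply: DF; rewrite in_cons ks orbT.
by apply/seteqP; split=> w /=; [move/andP|move=> [-> ->]].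
Qed.

Lemma sigma_rv_exists (I : finType) (F : I -> pred Omega) :
  (forall i, sigma_rv D X [set w | F i w]) ->
  sigma_rv D X [set w | [exists i, F i w]].
Proof.
move=> DF; rewrite [X in sigma_rv _ _ X](_ : _ =
    ~` [set w | all (fun i => ~~ F i w) (enum I)]).
  apply: sigma_rvC; apply: sigma_rv_all => i _.
  rewrite [X in sigma_rv _ _ X](_ : _ = ~` [set w | F i w]).
    exact: sigma_rvC.
  by apply/seteqP; split=> w /= /negP.
apply/seteqP; split=> w /=.
  by move=> /existsP[i Fi] /allP /(_ i); rewrite mem_enum Fi => /(_ isT).
move=> /negP/allPn[i _]; rewrite negbK => Fi; by apply/existsP; exists i.
Qed.

End generated_events.

(** * The branching property *)

Section survival.
Context {dO : measure_display} {Omega : measurableType dO} {R : realType}.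
Variables (P : probability Omega R) (m : nat -> nat).
Variable nu : bool -> forall j, probability ((m j).-tuple bool) R.
Variable X : seq nat -> Omega -> bool.
Hypothesis hX : branching_chain P nu X.

(** Recursing through the children, rather than quantifying over
    descendants, exposes the branching structure and keeps the event boolean. *)
Fixpoint alive (n : nat) (u : seq nat) (w : Omega) : bool :=
  X u w && if n is n'.+1
           then [exists k : 'I_(m (size u)), alive n' (child u k) w] else true.

Lemma alive_state n u w : alive n u w -> X u w.
Proof. by case: n => [|n] /= /andP[]. Qed.

Lemma alive_pred n u w : alive n.+1 u w -> alive n u w.
Proof.
elim: n u => [|n IH] u /=; first by rewrite andbT => /andP[].
case/andP=> -> /existsP[k ak] /=; apply/existsP; exists k.
exact: IH.
Qed.

Lemma alive_le n n' u w : (n <= n')%N -> alive n' u w -> alive n u w.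
Proof.
move/subnKC <-; elim: (n' - n)%N => [|k IH]; first by rewrite addn0.
by rewrite addnS => /alive_pred.
Qed.

Lemma sigma_rv_alive (D : set (seq nat)) n u : U m 0 u -> D u ->
  concat_set u (Ustar m (size u)) `<=` D ->
  sigma_rv D X [set w | alive n u w].
Proof.
elim: n u => [|n IH] u Uu Du Dsub.
  rewrite [X in sigma_rv _ _ X](_ : _ = X u @^-1` [set true]).
    exact: sigma_rv_state.
  by apply/seteqP; split=> w /=; rewrite andbT.
rewrite [X in sigma_rv _ _ X](_ : _ = X u @^-1` [set true] `&`
    [set w | [exists k : 'I_(m (size u)), alive n (child u k) w]]); last first.
  by apply/seteqP; split=> w /=; [move/andP|move=> [-> ->]].
apply: sigma_rvI; first exact: sigma_rv_state.
apply: sigma_rv_exists => k; apply: IH; first exact: U_child.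
  apply: Dsub; exists [:: k.+1]; last by rewrite cats1.
  by split=> // -[_ /=|//]; rewrite addn0 ltn_ord.
by move=> v /descendant_parent /Dsub.
Qed.

Lemma measurable_sigma_rv (D : set (seq nat)) :
  D `<=` U m 0 -> sigma_rv D X `<=` measurable.
Proof.
move=> DU; apply: smallest_sub; first exact: sigma_algebra_measurable.
move=> A [u Du [B mB <-]]; exact: (bc_rv hX (DU _ Du)).
Qed.

Lemma past_sub u : U m 0 `\` concat_set u (Ustar m (size u)) `<=` U m 0.
Proof. by move=> v []. Qed.

Lemma measurable_past u : past m X u `<=` measurable.
Proof. exact: measurable_sigma_rv (@past_sub u). Qed.

Lemma measurable_state u b : U m 0 u -> measurable [set w | X u w = b].
Proof.
by move=> Uu; rewrite -[X in measurable X]setTI;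
   apply: (bc_rv hX Uu measurableT (Y := [set b])).
Qed.

Lemma measurable_alive n u : U m 0 u -> measurable [set w | alive n u w].
Proof.
move=> Uu; apply: (@measurable_sigma_rv (U m 0)) => //.
by apply: sigma_rv_alive => // v [v' [Uv' _] <-]; apply: U_cat.
Qed.

Lemma past_state u b : U m 0 u -> past m X u [set w | X u w = b].
Proof.
move=> Uu; apply: (@sigma_rv_state _ _ _ _ u [set b]); split=> //.
by move=> /descendantE[_]; rewrite ltnn.
Qed.

(** On the event that [u] has state [b], the conditional probability in the
    Markov property is the constant [nu b (size u) B]. *)
Lemma markov_step u b (A : set Omega) (B : set ((m (size u)).-tuple bool)) :
  U m 0 u -> past m X u A ->
  P (A `&` [set w | X u w = b] `&` (Xvec m X u @^-1` B)) =
  (nu b (size u) B * P (A `&` [set w | X u w = b]))%E.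
Proof.
move=> Uu pA; have pAb := sigma_rvI pA (past_state b Uu).
have [_ /(_ _ pAb) <-] := bc_markov hX Uu B.
rewrite (eq_integral (fun=> nu b (size u) B)); last first.
  by move=> w; rewrite inE => -[_ /= ->].
rewrite integral_cst //; exact: (measurable_past pAb).
Qed.


Lemma measure_fin_partition (T : finType) (Y : Omega -> T) (A : set Omega) :
  (forall t, measurable (A `&` Y @^-1` [set t])) ->
  P A = (\sum_t P (A `&` Y @^-1` [set t]))%E.
Proof.
move=> mA; rewrite (@fsbig_seq _ _ _ _ (index_enum T)) ?index_enum_uniq //.
rewrite -measure_fin_bigcup //; last first.
  apply/trivIsetP => s t _ _ st; rewrite -subset0 => w [[_ /= ws] [_ /= wt]].
  by rewrite -ws -wt eqxx in st.
congr (P _); apply/seteqP; split=> [w Aw|w [t _ []//]].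
by exists (Y w); rewrite //= mem_index_enum.
Qed.

(** The states that are in the past of every child of [u] simultaneously: they
    include [u] and its children, but nothing further below. *)
Let past_children (u : seq nat) : set (seq nat) :=
  [set v | U m 0 v /\ forall k : 'I_(m (size u)),
     ~ concat_set (child u k) (Ustar m (size (child u k))) v].

Lemma past_sub_children u A : past m X u A -> sigma_rv (past_children u) X A.
Proof.
apply: sigma_rvS => v [Uv nuv]; split=> // k /descendant_parent; exact: nuv.
Qed.

Lemma past_children_child u (k : 'I_(m (size u))) :
  U m 0 u -> past_children u (child u k).
Proof.
move=> Uu; split=> [|l /descendantE[_]]; first exact: U_child.
by rewrite !size_child ltnn.
Qed.

Lemma past_children_self u : U m 0 u -> past_children u u.
Proof.
move=> Uu; split=> // k /descendantE[_]; rewrite size_child.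
by rewrite ltnNge leqnSn.
Qed.

(** The subtrees of two siblings are disjoint, so the fate of one sibling belongs
    to the past of the other. *)
Lemma past_sibling_alive u (k l : 'I_(m (size u))) n : U m 0 u -> k != l ->
  past m X (child u k) [set w | alive n (child u l) w].
Proof.
move=> Uu kl; apply: sigma_rv_alive; first exact: U_child.
  split; first exact: U_child.
  by move=> /descendantE[_]; rewrite !size_child ltnn.
move=> v vl; split.
  by have [v' [Uv' _] <-] := vl; apply: U_cat => //; apply: U_child.
move=> /descendantE[vk _]; have [vl' _] := descendantE vl.
move: vl' kl; rewrite size_child -(size_child u k) vk => /child_inj e.
by rewrite (val_inj e) eqxx.
Qed.

(** The children are removed one at a time: the extinction of the remaining
    siblings is in the past of the removed child, whose own extinction therefore
    contributes a factor [q]. *)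
Lemma extinct_children n u (q : R) : U m 0 u ->
  (forall (k : 'I_(m (size u))) A, past m X (child u k) A ->
    P (A `&` [set w | X (child u k) w = true]
         `&` [set w | ~~ alive n (child u k) w]) =
    (P (A `&` [set w | X (child u k) w = true]) * q%:E)%E) ->
  forall (s : seq 'I_(m (size u))) B, uniq s ->
    sigma_rv (past_children u) X B ->
    (forall k, k \in s -> B `<=` [set w | X (child u k) w]) ->
    P (B `&` [set w | all (fun k : 'I__ => ~~ alive n (child u k) w) s]) =
    (P B * (q ^+ size s)%:E)%E.
Proof.
move=> Uu IH; elim=> [|k s IHs] B.
  move=> _ _ _; rewrite expr0 mule1; congr (P _).
  by apply/seteqP; split=> [w []|w].
move=> /= /andP[ks us] pB BX.
pose B' := B `&` [set w | all (fun k : 'I__ => ~~ alive n (child u k) w) s].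
have B'X : B' `&` [set w | X (child u k) w = true] = B'.
  by apply/setIidl => w [Bw _]; apply: BX Bw; rewrite mem_head.
have pB' : past m X (child u k) B'.
  apply: sigma_rvI.
    by apply: sigma_rvS pB => v [Uv nv]; split=> //; apply: nv.
  apply: sigma_rv_all => l ls; rewrite (_ : mkset _ = ~` [set w | alive n (child u l) w]).
    apply: sigma_rvC; apply: past_sibling_alive => //.
    by apply: contraNneq ks => ->.
  by apply/seteqP; split=> w /= /negP.
have -> : B `&` [set w | ~~ alive n (child u k) w &&
      all (fun k : 'I__ => ~~ alive n (child u k) w) s] =
    B' `&` [set w | X (child u k) w = true] `&`
       [set w | ~~ alive n (child u k) w].
  rewrite B'X; apply/seteqP; split=> w /=; first by move=> [Bw /andP[]].
  by move=> [[Bw ->] ->].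
rewrite IH // B'X IHs // => [|l ls]; last by apply: BX; rewrite in_cons ls orbT.
by rewrite -muleA -EFinM exprSr.
Qed.

Definition extinct_within (j n : nat) : R := foldr (phi nu true) 0 (iota j n).

(** Conditioning on the states [x] of the children leaves one factor for each of
    the [ones x] children of state 1; summing over [x] applies the offspring
    generating function once more. The past event [A] is carried along because
    the induction hypothesis is used at a child, relative to events that involve
    its siblings. *)
Lemma extinction_prob n u A : U m 0 u -> past m X u A ->
  P (A `&` [set w | X u w = true] `&` [set w | ~~ alive n u w]) =
  (P (A `&` [set w | X u w = true]) * (extinct_within (size u) n)%:E)%E.
Proof.
elim: n u A => [|n IH] u A Uu pA.
  rewrite mule0 -[RHS](measure0 P); congr (P _).
  by apply/seteqP; split=> // w [[_ /= ->]].
set q := extinct_within (size u).+1 n.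
have Psub := @extinct_children n u q Uu.
set G := A `&` _ `&` _.
have IH' (k : 'I_(m (size u))) B : past m X (child u k) B ->
    P (B `&` [set w | X (child u k) w = true]
         `&` [set w | ~~ alive n (child u k) w]) =
    (P (B `&` [set w | X (child u k) w = true]) * q%:E)%E.
  by move=> pB; rewrite IH ?size_child //; apply: U_child.
pose sx (x : (m (size u)).-tuple bool) := [seq k <- enum 'I_(m (size u)) | tnth x k].
have size_sx x : size (sx x) = ones x.
  rewrite size_filter -sum1_count big_enum_cond /= /ones big_mkcond.
  by apply: eq_bigr => k _; case: (tnth x k).
pose Bx x := A `&` [set w | X u w = true] `&` Xvec m X u @^-1` [set x].
have XvecE x w : Xvec m X u w = x <-> forall k : 'I__, X (child u k) w = tnth x k.
  split=> [<- k|h]; first by rewrite tnth_mktuple.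
  by apply: eq_from_tnth => k; rewrite tnth_mktuple.
have pBx x : sigma_rv (past_children u) X (Bx x).
  apply: sigma_rvI.
    apply: sigma_rvI; first exact: past_sub_children.
    by apply: (@sigma_rv_state _ _ _ _ u [set true]); apply: past_children_self.
  rewrite (_ : _ @^-1` _ =
      [set w | all (fun k : 'I__ => X (child u k) w == tnth x k)
                   (enum 'I_(m (size u)))]).
    apply: sigma_rv_all => k _.
    rewrite (_ : mkset _ = X (child u k) @^-1` [set tnth x k]).
      by apply: sigma_rv_state; apply: past_children_child.
    by apply/seteqP; split=> w /= /eqP.
  apply/seteqP; split=> w /=.
    by move=> /XvecE h; apply/allP => k _; rewrite h.
  by move=> /allP h; apply/XvecE => k; apply/eqP/h; rewrite mem_enum.
have GxE x : G `&` Xvec m X u @^-1` [set x] =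
    Bx x `&` [set w | all (fun k : 'I__ => ~~ alive n (child u k) w) (sx x)].
  apply/seteqP; split=> w /=.
    move=> [[[Aw Xw]]]; rewrite /= Xw /= negb_exists => /forallP ext xw.
    by split=> //; apply/allP => k _.
  move=> [[[Aw Xw] /XvecE xw] /allP ext]; split; last by apply/XvecE.
  split=> //=; rewrite Xw /= negb_exists; apply/forallP => k.
  case xk: (tnth x k); first by apply: ext; rewrite mem_filter xk mem_enum.
  by apply/negP => /alive_state; rewrite xw xk.
have mBx x : measurable (Bx x).
  by apply: (@measurable_sigma_rv (past_children u)) (pBx x) => v [].
have mAX : measurable (A `&` [set w | X u w = true]).
  by apply: measurableI; [exact: (measurable_past pA)|exact: measurable_state].
have PGx x : P (G `&` Xvec m X u @^-1` [set x]) =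
    (P (A `&` [set w | X u w = true]) * (mass (nu true (size u)) x * q ^+ ones x)%:E)%E.
  rewrite GxE (Psub IH') //; last 2 first.
  - by rewrite filter_uniq // enum_uniq.
  - by move=> k; rewrite mem_filter => /andP[xk _] w [_ /XvecE xw] /=; rewrite xw.
  rewrite size_sx /Bx markov_step // EFinM muleA; congr (_ * _)%E.
  by rewrite muleC; congr (_ * _)%E; apply: massE.
rewrite (measure_fin_partition (Y := Xvec m X u)); last first.
  move=> x; rewrite GxE; apply: measurableI => //.
  apply: (@measurable_sigma_rv (U m 0)) => //; apply: sigma_rv_all => k _.
  rewrite (_ : mkset _ = ~` [set w | alive n (child u k) w]).
    apply: sigma_rvC; apply: sigma_rv_alive => //; [exact: U_child..|].
    by move=> v [v' [Uv' _] <-]; apply: U_cat => //; apply: U_child.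
  by apply/seteqP; split=> w /= /negP.
under eq_bigr do rewrite PGx.
rewrite -(@fineK _ (P (A `&` _))) ?fin_num_measure //.
under eq_bigr do rewrite -EFinM.
rewrite sumEFin -mulr_sumr EFinM; congr (_ * (_)%:E)%E.
by rewrite /extinct_within /= -/(extinct_within _ _) phiE.
Qed.

End survival.

(** * Infinite lines of descent *)

Section lines_of_descent.
Context {dO : measure_display} {Omega : measurableType dO}.
Variables (m : nat -> nat) (X : seq nat -> Omega -> bool).
Variable w : Omega.

Let alive := alive m X.

(** Otherwise every child has only finitely many generations of state-1
    descendants, and the maximum of these numbers over the finitely many children
    bounds the number of generations below [u]. *)
Lemma immortal_child u : (forall n, alive n u w) ->
  exists2 k, (k < m (size u))%N & forall n, alive n (child u k) w.
Proof.
move=> au; apply: contrapT => /forall2NP h.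
have {}h (k : 'I_(m (size u))) : exists n, ~~ alive n (child u k) w.
  by case: (h k) => [|/existsNP[n /negP nk]]; [rewrite ltn_ord|exists n].
have [N hN] := choice h.
have /andP[_ /existsP[k]] := au (\max_k N k).+1.
by move=> /(alive_le (leq_bigmax k)); apply/negP; apply: hN.
Qed.

Lemma tau_self u : X u w -> tau m X u w u.
Proof.
move=> Xu; split; first by exists [::] => //; rewrite cats0.
by move=> j; rewrite -eqn_leq => /eqP <-; rewrite take_size.
Qed.

Lemma tau_child u v k : (k < m (size v))%N -> X (child v k) w ->
  tau m X u w v -> tau m X u w (child v k).
Proof.
move=> kv Xvk [[v' Uv' def_v] Xv]; split.
  exists (child v' k); last by rewrite /child -rcons_cat def_v.
  move=> i; rewrite size_child ltnS /child nth_rcons leq_eqVlt.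
  move=> /predU1P[->|iv']; last by rewrite iv'; apply: Uv'.
  by rewrite ltnn eqxx -size_cat def_v.
move=> j; rewrite size_child [(j <= _)%N]leq_eqVlt => /andP[uj /predU1P[->|jv]].
  by rewrite -(size_child v k) take_size.
by rewrite /child -cats1 takel_cat // Xv // uj.
Qed.

(** Koenig's lemma: following an immortal child at each step yields an infinite
    branch. *)
Lemma immortal_boundary u : (forall n, alive n u w) -> boundary_tau m X u w !=set0.
Proof.
move=> au.
have /choice[g gP] : forall v, exists k, (forall n, alive n v w) ->
    (k < m (size v))%N /\ forall n, alive n (child v k) w.
  move=> v; have [av|nav] := pselect (forall n, alive n v w).
    by have [k kv ak] := immortal_child av; exists k.
  by exists 0%N.
pose W i := iter i (fun v => child v (g v)) u.
have WS i : W i.+1 = child (W i) (g (W i)) by [].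
have sizeW i : size (W i) = (size u + i)%N.
  by elim: i => [|i IH]; rewrite ?addn0 ?WS ?size_child ?IH ?addnS.
have aW i : forall n, alive n (W i) w.
  by elim: i => // i IH; have [_] := gP _ IH.
have tauW i : tau m X u w (W i).
  elim: i => [|i IH]; first by apply: tau_self; apply: alive_state (au 0%N).
  rewrite WS; have [kW ak] := gP _ (aW i).
  by apply: tau_child => //; apply: alive_state (ak 0%N).
have nthW i n l : (l < size (W i))%N -> nth 0%N (W (i + n)%N) l = nth 0%N (W i) l.
  move=> li; elim: n => [|n IH]; first by rewrite addn0.
  rewrite addnS WS /child nth_rcons sizeW ifT ?IH // addnA.
  by apply: leq_trans (leq_addr _ _); rewrite -sizeW.
exists (fun l => nth 0%N (W l.+1) l) => j uj.
suff -> : prefix_word (fun l => nth 0%N (W l.+1) l) j = W (j - size u)%N by [].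
apply: (@eq_from_nth _ 0%N); rewrite size_mkseq; first by rewrite sizeW subnKC.
move=> l lj; rewrite nth_mkseq //.
rewrite -(@nthW l.+1 (j - size u)%N) ?sizeW; last by rewrite addnS ltnS leq_addl.
by rewrite addnC nthW // sizeW subnKC.
Qed.

(** Letters of words start at 1 whereas children are indexed from 0, so the
    index of the child is the predecessor of the letter. *)
Lemma boundary_letter u zeta j : (size u <= j)%N -> boundary_tau m X u w zeta ->
  exists2 k : 'I_(m j), X (prefix_word zeta j.+1) w &
    prefix_word zeta j.+1 = child (prefix_word zeta j) k.
Proof.
move=> uj /(_ j.+1 (leqW uj)) [[v Uv def_v] Xz].
have szv : (size u + size v)%N = j.+1 by rewrite -size_cat def_v size_mkseq.
have := Uv (j - size u)%N; rewrite subnKC // ltn_subLR // szv => /(_ (leqnn _)).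
have -> : nth 0%N v (j - size u) = zeta j.
  by rewrite -(@nth_mkseq _ 0%N zeta j.+1 j) // -[mkseq _ _]def_v nth_cat ltnNge uj.
case def_k: (zeta j) => [//|k] /= km; exists (Ordinal km).
  have := Xz j.+1; rewrite size_mkseq (leqW uj) leqnn => /(_ isT).
  by rewrite take_oversize ?size_mkseq.
by rewrite /prefix_word /child /= -def_k mkseqS.
Qed.

Lemma boundary_immortal u zeta j : (size u <= j)%N ->
  boundary_tau m X u w zeta -> forall n, alive n (prefix_word zeta j) w.
Proof.
move=> uj bz n; elim: n j uj => [|n IH] j uj.
  rewrite /alive /= andbT; have [_ /(_ j)] := bz _ uj.
  by rewrite size_mkseq uj leqnn take_oversize ?size_mkseq //; apply.
have [_ /(_ j)] := bz _ uj.
rewrite /alive /= size_mkseq uj leqnn take_oversize ?size_mkseq // => ->//=.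
have [k _ ek] := boundary_letter uj bz.
by apply/existsP; exists k; rewrite -ek; apply: IH; apply: leqW.
Qed.

Lemma boundary_word u zeta j : U m 0 u -> (size u <= j)%N ->
  boundary_tau m X u w zeta -> U m 0 (prefix_word zeta j).
Proof. by move=> Uu uj /(_ _ uj) [[v Uv <-] _]; apply: U_cat. Qed.

End lines_of_descent.

Section limit_set_events.
Context {dO : measure_display} {Omega : measurableType dO} {R : realType}.
Context {d : nat} (m : nat -> nat).
Variables (J : seq nat -> Omega -> set 'rV[R]_d) (X : seq nat -> Omega -> bool).

(** A boundary sequence of [u] remains one for each of its longer prefixes, so
    [j0] can be arbitrary. The right-hand side exhibits the event as measurable
    and reduces its probability to that of immortality of single words. *)
Lemma Theta_empty_event (j0 : nat) :
  [set w | Theta m J X w = set0] =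
  ~` \bigcup_(u in [set u | U m 0 u /\ (j0 <= size u)%N])
       \bigcap_n [set w | alive m X n u w].
Proof.
apply/seteqP; split=> w /=.
  move=> T0 [u [Uu _] au]; have [zeta bz] : boundary_tau m X u w !=set0.
    by apply: immortal_boundary => n; apply: au.
  suff : Theta m J X w (xpoint J w zeta) by rewrite T0.
  by exists u => //; exists zeta.
move=> nimm; rewrite -subset0 => x [u Uu [zeta bz _]]; apply: nimm.
have uj : (size u <= maxn j0 (size u))%N by rewrite leq_maxr.
exists (prefix_word zeta (maxn j0 (size u))).
  by split; [exact: boundary_word bz|rewrite size_mkseq leq_maxl].
by move=> n _; apply: boundary_immortal bz n.
Qed.

End limit_set_events.

(** * Almost sure properties of generations *)

Section null_unions.
Context {dO : measure_display} {Omega : measurableType dO} {R : realType}.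
Variable P : probability Omega R.

Lemma bigcup_pickle (I : countType) (W : set I) (E : I -> set Omega) :
  \bigcup_(u in W) E u =
  \bigcup_i (if unpickle i is Some u then [set w | W u /\ E u w] else set0).
Proof.
apply/seteqP; split=> w [u Wu Eu].
  by exists (pickle u) => //; rewrite pickleK.
by case: (unpickle u) Eu => // v [Wv Ev]; exists v.
Qed.

Lemma measurable_countable_bigcup (I : countType) (W : set I) (E : I -> set Omega) :
  (forall u, W u -> measurable (E u)) -> measurable (\bigcup_(u in W) E u).
Proof.
move=> mE; rewrite bigcup_pickle; apply: bigcupT_measurable => i.
case: (unpickle i) => [u|]; last exact: measurable0.
have [Wu|nWu] := pselect (W u); last first.
  by rewrite (_ : mkset _ = set0) //; apply/seteqP; split=> w [].
by rewrite (_ : mkset _ = E u); [exact: mE|apply/seteqP; split=> w // []].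
Qed.

Lemma countable_bigcup_ae_compl (I : countType) (W : set I) (E : I -> set Omega) :
  (forall u, W u -> measurable (E u)) ->
  P (~` \bigcup_(u in W) E u) = 1%E <-> forall u, W u -> P (E u) = 0%E.
Proof.
move=> mE; have mU := measurable_countable_bigcup mE.
rewrite probability_setC //; split=> [h u Wu|h].
  have U0 : P (\bigcup_(u in W) E u) = 0%E.
    move: h; rewrite -(@fineK _ (P (\bigcup_(u in W) E u))) ?fin_num_measure //.
    by rewrite -EFinB => -[] h; congr (_%:E); lra.
  apply/eqP; rewrite -measure_le0 -U0; apply: le_measure; rewrite ?inE //.
    exact: mE.
  by move=> w Ew; exists u.
suff -> : P (\bigcup_(u in W) E u) = 0%E by rewrite sube0.
apply: (measure_negligible mU); rewrite bigcup_pickle.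
apply: negligible_bigcup => i; case: (unpickle i) => [u|]; last exact: negligible_set0.
have [Wu|nWu] := pselect (W u); last first.
  rewrite (_ : mkset _ = set0); first exact: negligible_set0.
  by apply/seteqP; split=> w [].
rewrite (_ : mkset _ = E u); last by apply/seteqP; split=> w // [].
by apply/negligibleP; [exact: mE|exact: h].
Qed.

End null_unions.

Section generations.
Context {dO : measure_display} {Omega : measurableType dO} {R : realType}.
Variables (P : probability Omega R) (m : nat -> nat).
Hypothesis m_gt0 : forall j, (0 < m j)%N.
Variable nu : bool -> forall j, probability ((m j).-tuple bool) R.
Variable X : seq nat -> Omega -> bool.
Hypothesis hX : branching_chain P nu X.

(** The events that [u] has state-1 descendants [n] generations below decrease to
    the event of immortality, and [extinction_prob] gives their probabilities. *)
Lemma immortal_prob u : U m 0 u ->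
  P (\bigcap_n [set w | alive m X n u w]) =
  (P [set w | X u w = true] * (1 - fext nu (size u))%:E)%E.
Proof.
move=> Uu; have mX := measurable_state hX true Uu.
have mA n := measurable_alive hX n Uu.
have PXE : P [set w | X u w = true] = (fine (P [set w | X u w = true]))%:E.
  by rewrite fineK // fin_num_measure.
set p := fine _ in PXE.
have PA n : P [set w | alive m X n u w] =
    (p * (1 - extinct_within nu (size u) n))%:E.
  have := extinction_prob hX n Uu (@sigma_rvT _ _ X _).
  rewrite !setTI PXE -EFinM => PXD.
  rewrite (_ : mkset _ = [set w | X u w = true] `\` [set w | ~~ alive m X n u w]).
    have mD : measurable [set w | ~~ alive m X n u w].
      rewrite (_ : mkset _ = ~` [set w | alive m X n u w]).
        exact: measurableC.
      by apply/seteqP; split=> w /= /negP.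
    have PXlty : (P [set w | X u w = true] < +oo)%E by rewrite PXE ltry.
    have hD : P ([set w | X u w = true] `\` [set w | ~~ alive m X n u w]) =
        (P [set w | X u w = true] -
         P ([set w | X u w = true] `&` [set w | ~~ alive m X n u w]))%E.
      exact: measureD mX mD PXlty.
    by rewrite hD PXE PXD -EFinB mulrBr mulr1.
  apply/seteqP; split=> w /=; last by move=> [_ /negP]; rewrite negbK.
  by move=> a; split; [exact: alive_state a|apply/negP; rewrite negbK].
have c1 : P [set w | alive m X n u w] @[n --> \oo] -->
    P (\bigcap_n [set w | alive m X n u w]).
  have A0lty : (P [set w | alive m X 0 u w] < +oo)%E by rewrite PA ltry.
  apply: nonincreasing_cvg_mu => //.
  - exact: bigcapT_measurable.
  - by move=> n n' nn'; apply/subsetPset => w; apply: alive_le.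
have c2 : P [set w | alive m X n.+1 u w] @[n --> \oo] -->
    (p * (1 - fext nu (size u)))%:E.
  under eq_fun do rewrite PA.
  apply: cvg_EFin; first exact: nearW.
  apply: cvgMr; apply: cvgB; first exact: cvg_cst.
  exact: is_cvg_phi_comp0.
have c3 : P [set w | alive m X n.+1 u w] @[n --> \oo] -->
    P (\bigcap_n [set w | alive m X n u w]).
  by rewrite (cvg_shiftS (fun n => P [set w | alive m X n u w])).
by rewrite PXE -EFinM; apply: (cvg_unique _ c3 c2).
Qed.

(** With 0^0 = 1, evaluation at 0 keeps only the all-zero tuple. *)
Lemma phi0E t j : (phi nu t j 0)%:E = nu t j [set [tuple false | k < m j]].
Proof.
set z := [tuple _ | _ < _]; rewrite phiE /pgf (bigD1 z) //= big1 => [|x xz].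
  rewrite /ones big1 => [|k _]; last by rewrite tnth_mktuple.
  by rewrite expr0 mulr1 addr0 massE.
suff : (0 < ones x)%N by case: (ones x) => // n _; rewrite exprS mul0r mulr0.
apply: contraNT xz; rewrite -eqn0Ngt /ones sum_nat_eq0 => /forallP x0.
apply/eqP/eq_from_tnth => k; rewrite tnth_mktuple.
by have := x0 k; rewrite /= eqb0 => /negbTE.
Qed.

Lemma finite_generation j : finite_set [set u | U m 0 u /\ size u = j].
Proof.
elim: j => [|j IH].
  apply: (@sub_finite_set _ _ [set [::]]); last exact: finite_set1.
  by move=> u /= [_ /size0nil].
apply: (@sub_finite_set _ _ (\bigcup_(v in [set u | U m 0 u /\ size u = j])
   \bigcup_(k in `I_(m j)) [set child v k])).
  move=> u [Uu su]; have [v [k [Uv sv uvk]]] := U_childP Uu su.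
  by exists v => //; exists (k : nat); rewrite //= -sv ltn_ord.
apply: bigcup_finite => // v _; apply: bigcup_finite => // k _.
Qed.

Lemma Sgen_empty_event j : [set w | Sgen m X j w = set0] =
  ~` \bigcup_(u in [set u | U m 0 u /\ size u = j]) [set w | X u w = true].
Proof.
apply/seteqP; split=> w /=.
  by move=> S0 [u [Uu su] Xu]; have : Sgen m X j w u by []; rewrite S0.
move=> nX; rewrite -subset0 => u [Uu su Xu]; apply: nX.
by exists u.
Qed.

Lemma Phi0E j : Phi P m X j 0 = P [set w | Sgen m X j w = set0].
Proof.
rewrite /Phi -expectation_indic; last first.
  rewrite Sgen_empty_event; apply: measurableC.
  by apply: measurable_countable_bigcup => u [Uu _]; exact: (measurable_state hX).
congr expectation; apply/funext => w; rewrite indicE.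
have fS : finite_set (Sgen m X j w).
  by apply: sub_finite_set (finite_generation j) => u [].
have [S0|Sn0] := eqVneq (Sgen m X j w) set0.
  by rewrite mem_set // S0 fset_set0 /= expr0.
rewrite memNset /=; last by apply/eqP.
rewrite expr0n (_ : (_ == 0)%N = false) //; apply/negbTE.
apply: contra Sn0; rewrite finmap.cardfs_eq0 => /eqP S0; apply/eqP.
exact: (fset_set_set0 fS S0).
Qed.

Definition barren_from (j0 : nat) : Prop :=
  forall u, U m 0 u -> (j0 <= size u)%N -> P [set w | X u w = true] = 0%E.

(** If generation [j0] is in state 0 and individuals of state 0 have no child of
    state 1, state 0 propagates from one generation to the next by the Markov
    property. Conversely, any word of generation [j], such as
    1...1, has state 0 and only children of state 0 almost surely, so the law of
    the children of an individual of state 0 is concentrated on the all-zero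
    tuple. *)
Lemma barren_fromP (j0 : nat) : barren_from j0 <->
  Phi P m X j0 0 = 1%E /\ forall j, (j0 <= j)%N -> phi nu false j 0 = 1.
Proof.
rewrite Phi0E Sgen_empty_event countable_bigcup_ae_compl; last first.
  by move=> u [Uu _]; exact: (measurable_state hX).
split=> [bar|[bar0 phi1] u].
  split=> [u [Uu su]|j j0j]; first by apply: bar => //; rewrite su.
  have [u [Uu su]] : exists u, U m 0 u /\ size u = j.
    exists (nseq j 1%N); split; last exact: size_nseq.
    by move=> i; rewrite size_nseq nth_nseq => ->; rewrite /= m_gt0.
  move: j0j; rewrite -su => j0j; apply/EFin_inj; rewrite phi0E.
  set z := [tuple _ | _ < _].
  have := markov_step hX false [set z] Uu (@sigma_rvT _ _ X _).
  rewrite !setTI.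
  have PX0 : P [set w | X u w = false] = 1%E.
    rewrite (_ : mkset _ = ~` [set w | X u w = true]).
      by rewrite probability_setC ?bar ?sube0 //; exact: (measurable_state hX).
    by apply/seteqP; split=> w /=; case: (X u w).
  rewrite PX0 mule1 => <-.
  have -> : [set w | X u w = false] `&` Xvec m X u @^-1` [set z] =
      ~` \bigcup_(v in [set v | v = u \/ exists k : 'I_(m (size u)), v = child u k])
        [set w | X v w = true].
    apply/seteqP; split=> w /=.
      move=> [Xu xz] [v [->|[k ->]]]; first by rewrite /= Xu.
      have := congr1 (fun x => tnth x k) xz.
      by rewrite /= !tnth_mktuple => ->.
    move=> nX; split.
      by apply/negP => Xu; apply: nX; exists u => //; left.
    apply: eq_from_tnth => k; rewrite !tnth_mktuple; apply/negP => Xk; apply: nX.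
    by exists (child u k) => //; right; exists k.
  apply/countable_bigcup_ae_compl => v.
    by move=> [->|[k ->]]; apply: (measurable_state hX) => //; apply: U_child.
  move=> [->|[k ->]]; first exact: bar.
  by apply: bar; [exact: U_child|rewrite size_child leqW].
have [n su] : exists n, size u = n by exists (size u).
elim: n u su => [|n IH] u su Uu.
  by rewrite su leqn0 => /eqP j00; apply: bar0; split; rewrite ?su ?j00.
rewrite su leq_eqVlt ltnS => /predU1P[j0E|j0n].
  by apply: bar0; split; rewrite ?su ?j0E.
have [v [k [Uv sv uE]]] := U_childP Uu su; subst u.
set B := [set x : (m (size v)).-tuple bool | tnth x k].
have B0 : nu false (size v) B = 0%E.
  set z := [tuple false | _ < m (size v)].
  have z1 : nu false (size v) [set z] = 1%E by rewrite -phi0E phi1 // sv.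
  have zC0 : nu false (size v) (~` [set z]) = 0%E.
    rewrite probability_setC; last exact: measurable_tuple_bool.
    by rewrite [X in (1 - X)%E]z1 subee.
  apply/eqP; rewrite -measure_le0 -[X in (_ <= X)%E]zC0.
  apply: le_measure; rewrite ?inE; try exact: measurable_tuple_bool.
  by move=> x Bx /= xz; move: Bx; rewrite /B /= xz tnth_mktuple.
have Pv0 : P [set w | X v w = true] = 0%E by apply: IH => //; rewrite sv.
have := markov_step hX false B Uv (@sigma_rvT _ _ X _).
rewrite !setTI B0 mul0e => PvB.
have mXv b : measurable [set w | X v w = b] := measurable_state hX b Uv.
have mXu : measurable [set w | X (child v k) w = true] := measurable_state hX true Uu.
have XuB : Xvec m X v @^-1` B = [set w | X (child v k) w = true].
  by apply/seteqP; split=> w; rewrite /B /= tnth_mktuple.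
rewrite XuB in PvB.
apply: (measure_negligible mXu).
apply: (@negligibleS _ _ _ _ ([set w | X v w = true] `|`
  ([set w | X v w = false] `&` [set w | X (child v k) w = true]))).
  by move=> w /= Xw; case: (X v w); [left|right].
by apply: negligibleU; apply/negligibleP => //; apply: measurableI.
Qed.

End generations.

(** * The criterion for an empty limit set *)

Theorem proposition3 (R : realType) (dO : measure_display)
  (Omega : measurableType dO) (P : probability Omega R)
  (m : nat -> nat) (hm : forall j, (2 <= m j)%N)
  (d : nat) (hd : (1 <= d)%N)
  (blo bhi : R) (hblo : 0 < blo) (hbb : blo <= bhi) (hbhi : bhi < 1)
  (mu : forall j, probability ((m j).-tuple R) R)
  (hmu : forall j, mu j (cube blo bhi) = 1%E)
  (J : seq nat -> Omega -> set 'rV[R]_d)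
  (hJ : compact_family P mu J)
  (nu : bool -> forall j, probability ((m j).-tuple bool) R)
  (X : seq nat -> Omega -> bool)
  (hX : branching_chain P nu X)
  (hXL : independent_sigma P (sigma_rv (U m 0) X)
           (sigma_rv (Ustar m 0) (Lratio J)))
  (hdstar : (0 <= dstar blo bhi mu nu)%E)
  (hf : forall j, 0 < fext nu j) :
  let j0 := junder blo bhi mu nu in
  ((sigma_lower nu j0 = +oo%E \/
    (Phi P m X j0 0 = 1%E /\
     forall j, (j0 <= j)%N -> phi nu false j 0 = 1)) ->
   P [set w | Theta m J X w = set0] = 1%E) /\
  (P [set w | Theta m J X w = set0] = 1%E ->
   sigma_upper nu j0 = +oo%E \/
   (Phi P m X j0 0 = 1%E /\
    forall j, (j0 <= j)%N -> phi nu false j 0 = 1)).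
Proof.
move=> j0.
have jfin : junder_finite blo bhi mu nu.
  by move: hdstar; rewrite /dstar; case: pselect.
have dphi_gt0 j : (j0 <= j)%N -> 0 < dphi nu j.
  rewrite /j0 /junder; case: pselect => // h; case: ex_minnP => n /asboolP pos _.
  by move=> nj; rewrite -(alpha0E hmu); apply: pos.
have m_gt0 j : (0 < m j)%N by apply: leq_trans (hm j).
have mA n u (Uu : U m 0 u) := measurable_alive hX n Uu.
have Theta0P : P [set w | Theta m J X w = set0] = 1%E <->
    forall u, U m 0 u -> (j0 <= size u)%N ->
      (P [set w | X u w = true] * (1 - fext nu (size u))%:E)%E = 0%E.
  rewrite (Theta_empty_event m J X j0) countable_bigcup_ae_compl; last first.
    by move=> u [Uu _]; apply: bigcapT_measurable => n; apply: mA.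
  split=> [h u Uu j0u|h u [Uu j0u]].
    by rewrite -(immortal_prob hX Uu); apply: h.
  by rewrite (immortal_prob hX Uu); apply: h.
rewrite -(barren_fromP m_gt0 hX) Theta0P; split.
  move=> [/(sigma_lower_pinfty dphi_gt0) f1 u Uu j0u|bar u Uu j0u].
    move/eqP: f1; rewrite -(fext_eq1 dphi_gt0 j0u) => /eqP ->.
    by rewrite subrr mule0.
  by rewrite bar // mul0e.
move=> h; have [f1|fn1] := eqVneq (fext nu j0) 1.
  by left; apply: fext_eq1_sigma_upper.
right=> u Uu j0u; have /eqP := h u Uu j0u; rewrite mule_eq0.
case/orP => [/eqP //|]; rewrite eqe subr_eq0 eq_sym (fext_eq1 dphi_gt0 j0u).
by rewrite (negbTE fn1).
Qed.
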